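(* Let $n\ge2$ and let $\lambda[\Omega]$ be the Monge--Ampère eigenvalue of a bounded convex domain $\Omega$ in $\mathbb{R}^n$. Let $u\in C(\overline{\Omega})$ be a nonzero convex function on $\Omega$ with $u=0$ on $\partial\Omega$ that satisfies $$\int_\Omega|u|\det D^2u\,dx=\lambda[\Omega]\int_\Omega|u|^{n+1}\,dx .$$ Then $u$ is a Monge--Ampère eigenfunction of $\Omega$, that is, $$\det D^2u=\lambda[\Omega]\,|u|^n\ \text{ in }\Omega,\qquad u=0\ \text{ on }\partial\Omega,$$ where the equation holds in the sense of Aleksandrov.
   Context: A domain is a nonempty open connected set. For a convex function $u:\Omega\to\mathbb{R}$, the subdifferential at $x\in\Omega$ is $\partial u(x)=\{p\in\mathbb{R}^n: u(y)\ge u(x)+p\cdot(y-x)\ \text{for all } y\in\Omega\}$, and the Monge--Ampère measure of $u$ is $Mu(E)=\left|\bigcup_{x\in E}\partial u(x)\right|$ (Lebesgue measure) for Borel $E\subset\Omega$. For a general convex $u$, the notation $\det D^2u\,dx$ means $Mu$, so $\int_\Omega|u|\det D^2u\,dx=\int_\Omega|u|\,dMu$. A convex $u$ is an Aleksandrov solution of $\det D^2u=f$ in $\Omega$ if $Mu=f\,dx$ as Borel measures. $\mathbb{K}=\{w\in C(\overline{\Omega}): w\text{ is convex and nonzero in }\Omega,\ w=0\text{ on }\partial\Omega\}$. The Rayleigh quotient of a nonzero convex function $u$ on $\Omega$ with $\|u\|_{L^{n+1}(\Omega)}<\infty$ is $$R(u)=\frac{\int_\Omega|u|\det D^2u\,dx}{\int_\Omega|u|^{n+1}\,dx},$$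 and the Monge--Ampère eigenvalue of $\Omega$ is $\lambda[\Omega]=\inf_{w\in\mathbb{K}}R(w)$, which is known to be positive. *)

(* Defs.v *)
From HB Require Import structures.
From mathcomp Require Import all_boot all_order all_algebra.
From mathcomp Require Import all_classical all_reals all_analysis.
From mathcomp Require Import lra.

Set Implicit Arguments.
Unset Strict Implicit.
Unset Printing Implicit Defensive.

Import Order.TTheory GRing.Theory Num.Theory.
Import numFieldTopology.Exports numFieldNormedType.Exports.

Local Open Scope classical_set_scope.
Local Open Scope ring_scope.

(* Points of R^n are row vectors 'rV[R]_n.  The library norm on them is the sup
   norm, which induces the usual topology and the usual bounded sets. *)

Section lebesgue.
Context {R : realType} (n : nat).
Implicit Types (a b x : 'rV[R]_n) (A X : set 'rV[R]_n).

Definition box a b : set 'rV[R]_n :=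
  [set x | forall i, a ord0 i <= x ord0 i < b ord0 i].

Definition box_vol a b : R := \prod_i Num.max 0 (b ord0 i - a ord0 i).

(* The index set D lets a countable cover be finite or empty. *)
Definition box_cover A : set (set nat * (nat -> 'rV[R]_n * 'rV[R]_n)) :=
  [set F | A `<=` \bigcup_(k in F.1) box (F.2 k).1 (F.2 k).2].

Definition cover_vol (F : set nat * (nat -> 'rV[R]_n * 'rV[R]_n)) : \bar R :=
  (\esum_(k in F.1) (box_vol (F.2 k).1 (F.2 k).2)%:E)%E.

(* n-dimensional Lebesgue outer measure: a function of all sets, shown below to
   be a measure on the Borel sigma-algebra. *)
Definition lebesgue A : \bar R := ereal_inf [set cover_vol F | F in box_cover A].

Lemma box_vol_ge0 a b : 0 <= box_vol a b.
Proof. by apply: prodr_ge0 => i _; rewrite le_max lexx. Qed.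

Lemma cover_vol_ge0 F : (0 <= cover_vol F)%E.
Proof. by apply: esum_ge0 => k _; rewrite lee_fin box_vol_ge0. Qed.

Lemma lebesgue_ge0 A : (0 <= lebesgue A)%E.
Proof. by apply: le_ereal_inf_tmp => _ [F _ <-]; exact: cover_vol_ge0. Qed.

Lemma lebesgue0 : lebesgue set0 = 0%E.
Proof.
apply/eqP; rewrite eq_le lebesgue_ge0 andbT.
apply: ereal_inf_lbound; exists (set0, fun=> (0, 0)) => //=.
by rewrite /cover_vol/= esum_set0.
Qed.

Lemma le_lebesgue : {homo lebesgue : A B / A `<=` B >-> (A <= B)%E}.
Proof.
move=> A B AB; apply: ereal_inf_le_tmp => _ [F BF <-].
by exists F => //; exact: subset_trans BF.
Qed.

Lemma lebesgue_adherent A (e : R) : 0 < e -> lebesgue A != +oo%E ->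
  exists2 F, box_cover A F & (cover_vol F <= lebesgue A + e%:E)%E.
Proof.
move=> e0 Aoo; have Afin : lebesgue A \is a fin_num.
  by rewrite ge0_fin_numE ?lebesgue_ge0// ltey.
have [_ [F AF <-] FA] := lb_ereal_inf_adherent e0 Afin.
by exists F => //; exact: ltW.
Qed.

Lemma lebesgue_sigma_subadditive : sigma_subadditive lebesgue.
Proof.
move=> A; have [[i ioo]|] := pselect (exists i, lebesgue (A i) = +oo%E).
  by rewrite (eseries_pinfty _ _ ioo) ?leey// => k _;
    rewrite -ltNye (lt_le_trans _ (lebesgue_ge0 _)).
rewrite -forallNE => Aoo.
apply/lee_addgt0Pr => e e0.
apply: (@le_trans _ _
    (\sum_(i <oo) (lebesgue (A i) + (e / (2 ^ i.+1)%:R)%:E))%E); last first.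
  by apply: epsilon_trick => [i|]; [exact: lebesgue_ge0|exact: ltW].
have [F FP] : {F : nat -> set nat * (nat -> 'rV[R]_n * 'rV[R]_n) &
    forall i, box_cover (A i) (F i) /\
      (cover_vol (F i) <= lebesgue (A i) + (e / (2 ^ i.+1)%:R)%:E)%E}.
  apply: (@choice _ _ (fun i G => box_cover (A i) G /\
      (cover_vol G <= lebesgue (A i) + (e / (2 ^ i.+1)%:R)%:E)%E)) => i.
  have ei : 0 < e / (2 ^ i.+1)%:R by rewrite divr_gt0// ltr0n expn_gt0.
  have [|G AG GA] := @lebesgue_adherent (A i) _ ei; first exact/eqP.
  by exists G.
apply: (@le_trans _ _ (\sum_(i <oo) cover_vol (F i))%E); last first.
  by apply: lee_nneseries => [i _ _|i _]; [exact: cover_vol_ge0|exact: (FP i).2].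
rewrite nneseries_esumT; last by move=> i; exact: cover_vol_ge0.
rewrite /cover_vol esum_esum; last by move=> *; rewrite lee_fin box_vol_ge0.
have /card_esym/ppcard_eqP[f] := card_nat2.
pose G : set nat * (nat -> 'rV[R]_n * 'rV[R]_n) :=
  (f @^-1` ([set: nat] `*`` (fun i => (F i).1)),
   fun k => (F (f k).1).2 (f k).2).
rewrite [leRHS](_ : _ = cover_vol G); last first.
  rewrite /cover_vol/=.
  apply: (reindex_esum G.1 _ f
    (fun k => (box_vol ((F k.1).2 k.2).1 ((F k.1).2 k.2).2)%:E)).
  split => //=.
    by move=> x y _ _; apply: (@inj _ _ _ f); rewrite inE.
  by move=> y Fy; exists (f^-1%FUN y); rewrite /= ?invK ?inE.
apply: ereal_inf_lbound; exists G => //= x [i _] /((FP i).1)[k Fk xk].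
by exists (f^-1%FUN (i, k)) => /=; rewrite invK ?inE.
Qed.

HB.instance Definition _ := isOuterMeasure.Build R 'rV[R]_n lebesgue
  lebesgue0 lebesgue_ge0 le_lebesgue lebesgue_sigma_subadditive.

Definition update a i (c : R) : 'rV[R]_n :=
  \row_j if j == i then c else a ord0 j.

Lemma box_vol_split a b i c :
  box_vol a (update b i (Num.min (b ord0 i) c)) +
  box_vol (update a i (Num.max (a ord0 i) c)) b = box_vol a b.
Proof.
rewrite /box_vol (bigD1 i)//= [X in _ + X](bigD1 i)//= [RHS](bigD1 i)//=.
rewrite !mxE eqxx.
under eq_bigr => j ji do rewrite mxE (negbTE ji).
under [X in _ + _ * X]eq_bigr => j ji do rewrite mxE (negbTE ji).
rewrite -mulrDl; congr (_ * _); move: (a _ _) (b _ _) => s t.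
case: (ltP t c) => tc; case: (ltP s c) => sc; rewrite !maxEle;
  do ![case: ifP => ?]; lra.
Qed.

Lemma halfspace_caratheodory i (c : R) :
  lebesgue.-caratheodory [set x | x ord0 i < c].
Proof.
apply: le_caratheodory_measurable => X; set H := [set x | _].
apply: le_ereal_inf_tmp => _ [[D ab] XF <-].
rewrite /cover_vol/=.
pose F1 k := ((ab k).1, update (ab k).2 i (Num.min ((ab k).2 ord0 i) c)).
pose F2 k := (update (ab k).1 i (Num.max ((ab k).1 ord0 i) c), (ab k).2).
rewrite [leRHS](_ : _ = cover_vol (D, F1) + cover_vol (D, F2))%E; last first.
  rewrite /cover_vol/= -esumD; [|by move=> *; rewrite lee_fin box_vol_ge0..].
  by apply: eq_esum => k _; rewrite -EFinD box_vol_split.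
apply: leeD; apply: ereal_inf_lbound; eexists; try reflexivity.
  move=> x [/XF/= [k Dk xk]] Hx; exists k => //= j; rewrite mxE.
  case: eqP => [->|_]; last exact: xk.
  by have := xk i; rewrite lt_min => /andP[-> ->].
move=> x [/XF/= [k Dk xk]] /negP; rewrite -leNgt => Hx.
exists k => //= j; rewrite mxE; case: eqP => [->|_]; last exact: xk.
by have := xk i; rewrite ge_max => /andP[-> ->]; rewrite Hx.
Qed.

Lemma box_caratheodory a b : lebesgue.-caratheodory (box a b).
Proof.
rewrite (_ : box a b =
    \bigcap_(i in [set: 'I_n]) ([set x | x ord0 i < b ord0 i] `&`
                               ~` [set x | x ord0 i < a ord0 i])).
  apply: (@fin_bigcap_measurable _ (caratheodory_type lebesgue)) => // i _.
  apply: caratheodory_measurable_setI; first exact: halfspace_caratheodory.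
  exact/caratheodory_measurable_setC/halfspace_caratheodory.
apply/seteqP; split => x xab i.
  have /andP[ax xb] := xab i.
  by move=> _; split => //=; apply/negP; rewrite -leNgt.
by have [/= -> /negP] := xab i I; rewrite -leNgt => ->.
Qed.

Lemma open_caratheodory A : open A -> lebesgue.-caratheodory A.
Proof.
move=> oA.
pose Q (u : 'rV[rat]_n) : 'rV[R]_n := map_mx ratr u.
pose F (u : 'rV[rat]_n * 'rV[rat]_n) :=
  if pselect (box (Q u.1) (Q u.2) `<=` A) then box (Q u.1) (Q u.2) else set0.
rewrite (_ : A = \bigcup_u F u).
  apply: (@countable_bigcupT_measurable _ (caratheodory_type lebesgue)).
    exact: countableP.
  move=> u; rewrite /F; case: pselect => h /=; first by apply: box_caratheodory.
  exact: caratheodory_measurable_set0.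
apply/seteqP; split => [x Ax|x [u _]]; last first.
  by rewrite /F; case: pselect => //; apply.
have /nbhs_ballP[e /= e0 xe] : nbhs x A by exact: open_nbhs_nbhs.
have /choice[p px] i : exists q : rat, ratr q \in `]x ord0 i - e, x ord0 i[.
  by apply: rat_in_itvoo; rewrite ltrBlDr ltrDl.
have /choice[q qx] i : exists q : rat, ratr q \in `]x ord0 i, x ord0 i + e[.
  by apply: rat_in_itvoo; rewrite ltrDl.
exists (\row_i p i, \row_i q i) => //; rewrite /F; case: pselect => /= [_ i|].
  rewrite !mxE; have := px i; have := qx i; rewrite !in_itv/=.
  by move=> /andP[-> _] /andP[_ /ltW ->].
case=> y /= yb; apply: xe; split => // i j; rewrite ord1.
have := yb j; have := px j; have := qx j; rewrite !mxE !in_itv/= /ball/=.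
move=> /andP[_ ?] /andP[? _] /andP[? ?].
by rewrite ltr_norml; apply/andP; split; lra.
Qed.

Definition borel := g_sigma_algebraType (@open 'rV[R]_n).

HB.instance Definition _ := Pointed.on borel.
HB.instance Definition _ := Measurable.on borel.

Lemma borel_caratheodory (A : set borel) :
  measurable A -> lebesgue.-caratheodory A.
Proof.
apply: smallest_sub; last exact: open_caratheodory.
split; first exact: caratheodory_measurable_set0.
  by move=> B mB; rewrite setTD; exact: caratheodory_measurable_setC.
by move=> B mB; exact: caratheodory_measurable_bigcup.
Qed.

Let lebesgue_semi_sigma_additive :
  semi_sigma_additive (lebesgue : set borel -> \bar R).
Proof.
move=> F mF tF mUF.
apply: (@caratheodory_measure_sigma_additive R _ lebesgue) => // [i|];
  exact: borel_caratheodory.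
Qed.

HB.instance Definition _ := isMeasure.Build _ borel R
  (lebesgue : set borel -> \bar R)
  lebesgue0 lebesgue_ge0 lebesgue_semi_sigma_additive.

End lebesgue.

Arguments borel : clear implicits.
Arguments lebesgue {R n} A%_classical_set_scope.

Section monge_ampere.
Context {R : realType} {n : nat}.
Implicit Types (Omega : set 'rV[R]_n) (u w : 'rV[R]_n -> R).

Definition dotp (p x : 'rV[R]_n) : R := \sum_i p ord0 i * x ord0 i.

Definition domain Omega := [/\ Omega !=set0, open Omega & connected Omega].

Definition frontier Omega := closure Omega `\` Omega°.

Definition convex_on Omega u := @convex_function R 'rV[R]_n Omega u.

Definition subdifferential Omega u (x : 'rV[R]_n) : set 'rV[R]_n :=
  [set p | forall y, Omega y -> u y >= u x + dotp p (y - x)].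

(* For E a Borel subset of Omega this is Mu(E); for other Borel sets it is
   Mu(E `&` Omega), i.e., the extension of Mu to R^n carried by Omega.  It is
   kept as a set function: the library integral needs no measure structure. *)
Definition monge_ampere Omega u (E : set (borel R n)) : \bar R :=
  lebesgue (\bigcup_(x in E `&` Omega) subdifferential Omega u x).

Local Open Scope ereal_scope.

Local Notation leb := (lebesgue : set (borel R n) -> \bar R).

Definition energy Omega u : \bar R :=
  \int[monge_ampere Omega u]_(x in (Omega : set (borel R n))) `|u x|%:E.

Definition mass Omega u : \bar R :=
  \int[leb]_(x in (Omega : set (borel R n))) (`|u x| ^+ n.+1)%:E.

Definition rayleigh Omega u : \bar R := energy Omega u / mass Omega u.

(* Functions on the closure of Omega are represented by functions on R^n whose
   values off the closure are irrelevant. *)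
Definition admissible Omega : set ('rV[R]_n -> R) :=
  [set w | [/\ {within closure Omega, continuous w}, convex_on Omega w,
               exists2 x, Omega x & w x != 0%R &
               forall x, frontier Omega x -> w x = 0%R]].

Definition MA_eigenvalue Omega : \bar R :=
  ereal_inf [set rayleigh Omega w | w in admissible Omega].

Definition aleksandrov_solution Omega (f : 'rV[R]_n -> \bar R) u :=
  convex_on Omega u /\
  forall E : set (borel R n), measurable E -> E `<=` Omega ->
    monge_ampere Omega u E = \int[leb]_(x in E) f x.

Definition MA_eigenfunction Omega u :=
  aleksandrov_solution Omega (fun x => MA_eigenvalue Omega * (`|u x| ^+ n)%:E) u /\
  forall x, frontier Omega x -> u x = 0%R.

End monge_ampere.

(* Main.v *)
Require Import Defs.
From mathcomp Require Import all_boot all_order all_algebra.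
From mathcomp Require Import all_classical all_reals all_analysis.
From mathcomp Require Import measurable_realfun ring lra.
Import Order.TTheory GRing.Theory Num.Theory.
Import numFieldNormedType.Exports.

(** Let L w (p) be the maximum over y in the closure of Omega of p.y - w(y), and
    let h = L 0 be the support function of Omega.  For a continuous w <= 0 that
    vanishes off Omega, the gap L w - h is nonnegative, and the energy is linear
    in it:

      energy w = (n + 1) * integral over R^n of (L w - h).

    Indeed almost every slope p touches the graph of w at a single point T p.
    The Monge-Ampere measure is the image of Lebesgue measure under T, so the
    energy is the integral of |w(T p)| over the slopes p.  Now |w(T p)| is the
    derivative at s = 1 of the convex function s |-> L (s w)(p), while
    L (s w) - h, being the function p |-> s (L w - h)(p / s), has an integral
    proportional to s^(n+1).  Comparing the two derivatives gives the formula,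
    which is proved as the two inequalities [energy_le_gap] and
    [gap_le_energy].

    Given the formula, the Euler-Lagrange inequality needs no differentiation
    of the energy.  Let K be a compact subset of Omega and t > 0, push u down
    by t on K, and let w be the largest convex function below the result v.  It
    lies between a multiple of u and v, hence is admissible.  Passing from v to
    w does not change L, so L w <= L u + t, and L w <= L u off the set A_t of
    those slopes p for which L v (p) > L u (p).  As u is minimal,

      lambda (int |u|^(n+1) + (n+1) t int_K |u|^n) <= lambda int |w|^(n+1)
        <= energy w <= energy u + (n+1) t |A_t|,

    so that lambda int_K |u|^n <= |A_t|.  When t tends to 0 the sets A_t shrink
    to a set of slopes that touch the graph of u above K, and
    lambda int_K |u|^n <= Mu(K) follows ([monge_ampere_compact_ge]).  By inner
    regularity lambda |u|^n dx <= Mu on all Borel subsets of Omega.  By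
    hypothesis both measures give |u| the same finite integral.  As |u| > 0 in
    Omega, they are equal ([dominated_density_eq]).

    If lambda were infinite, the same comparison starting from 0 instead of u
    would show that Omega is a null set, and then both measures vanish. *)

Set Implicit Arguments.
Unset Strict Implicit.
Unset Printing Implicit Defensive.

Local Open Scope classical_set_scope.
Local Open Scope ring_scope.

(** * Lebesgue measure under affine maps *)

Lemma esumZl_le {R : realType} {T : choiceType} (D : set T) (c : R)
    (f : T -> R) : 0 <= c -> (forall i, 0 <= f i) ->
  (\esum_(i in D) (c * f i)%:E <= c%:E * \esum_(i in D) (f i)%:E)%E.
Proof.
move=> c0 f0; apply: ge_ereal_sup => _ [X XD <-].
under eq_fsbigr do rewrite EFinM.
rewrite -ge0_mule_fsumr; last by move=> i; rewrite lee_fin.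
by apply: lee_wpmul2l; rewrite ?lee_fin//; apply: esum_ge; exists X.
Qed.

Section lebesgue_affine.
Context {R : realType} {n : nat}.
Implicit Types (A B : set 'rV[R]_n) (s e : R) (a b v : 'rV[R]_n).

Lemma box_vol_affine a b s v : 0 <= s ->
  box_vol (s *: a + v) (s *: b + v) = s ^+ n * box_vol a b.
Proof.
move=> s0; have -> : s ^+ n = \prod_(i < n) s by rewrite prodr_const card_ord.
rewrite /box_vol -big_split/=.
apply: eq_bigr => i _; rewrite !mxE maxr_pMr// mulr0; congr Num.max; ring.
Qed.

Lemma lebesgue_affine_le A s v : 0 < s ->
  (lebesgue [set (s *: x + v)%R | x in A] <= (s ^+ n)%:E * lebesgue A)%E.
Proof.
move=> s0; rewrite muleC -lee_pdivrMr ?exprn_gt0//.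
apply: le_ereal_inf_tmp => _ [[D ab] XF <-].
rewrite lee_pdivrMr ?exprn_gt0// muleC.
pose F k := (s *: (ab k).1 + v, s *: (ab k).2 + v).
apply: (@le_trans _ _ (cover_vol (D, F))).
  apply: ereal_inf_lbound; exists (D, F) => //= _ [x Ax <-].
  have [k Dk xk] := XF _ Ax; exists k => //= i.
  by have := xk i; rewrite !mxE lerD2r ltrD2r ler_pM2l// ltr_pM2l.
rewrite /cover_vol/=; under eq_esum do rewrite box_vol_affine ?ltW//.
by apply: esumZl_le => [|k]; rewrite ?exprn_ge0 ?box_vol_ge0// ltW.
Qed.

Lemma lebesgue_affine A s v : 0 < s ->
  lebesgue [set (s *: x + v)%R | x in A] = ((s ^+ n)%:E * lebesgue A)%E.
Proof.
move=> s0; apply/eqP; rewrite eq_le lebesgue_affine_le//=.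
have si : 0 < s^-1 by rewrite invr_gt0.
have := @lebesgue_affine_le [set s *: x + v | x in A] s^-1 (- (s^-1 *: v)) si.
rewrite image_comp [X in (lebesgue X <= _)%E -> _](_ : _ = A); last first.
  apply/seteqP; split => [_ [x Ax <-] /=|x Ax].
    by rewrite scalerDr scalerA mulVf ?gt_eqF// scale1r addrK.
  by exists x => //=; rewrite scalerDr scalerA mulVf ?gt_eqF// scale1r addrK.
move=> /(lee_pmul _ _ (lexx (s ^+ n)%:E)).
rewrite muleA -EFinM -exprMn mulfV ?gt_eqF// expr1n mul1e; apply.
  by rewrite lee_fin exprn_ge0// ltW.
exact: lebesgue_ge0.
Qed.

Lemma lebesgue_box a b : (lebesgue (box a b) <= (box_vol a b)%:E)%E.
Proof.
rewrite (_ : (box_vol a b)%:E = cover_vol ([set 0%N], fun=> (a, b))).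
  apply: ereal_inf_lbound; exists ([set 0%N], fun=> (a, b)) => //= x xab.
  by exists 0%N.
by rewrite /cover_vol/= esum_set1// lee_fin box_vol_ge0.
Qed.

Lemma lebesgue_bounded_lty A (r : R) :
  (forall x, A x -> forall i, `|x ord0 i| <= r) -> (lebesgue A < +oo)%E.
Proof.
move=> Ar; apply: (@le_lt_trans _ _ (lebesgue (box (const_mx (- r)) (const_mx (r + 1))))).
  apply: le_lebesgue => x /Ar xr i; rewrite !mxE.
  have := xr i; rewrite ler_norml => /andP[-> xi]/=.
  by rewrite (le_lt_trans xi)// ltrDl.
exact: le_lt_trans (lebesgue_box _ _) (ltry _).
Qed.

End lebesgue_affine.

(** * Regularity of Lebesgue measure *)

Section lebesgue_regular.
Context {R : realType} {n : nat}.
Implicit Types (A B : set 'rV[R]_n) (s e r : R) (a b v : 'rV[R]_n).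
Local Notation leb := (lebesgue : set (borel R n) -> \bar R).

Lemma coord_le_norm (x : 'rV[R]_n) i : `|x ord0 i| <= `|x|.
Proof.
rewrite [leRHS]/Num.Def.normr /= mx_normrE.
exact: (@le_bigmax _ _ _ 0 (fun ij => `|x ij.1 ij.2|) (ord0, i)).
Qed.

Lemma open_coord_box a b :
  open [set x : 'rV[R]_n | forall i, a ord0 i < x ord0 i < b ord0 i].
Proof.
rewrite openE => x xab.
suff : \forall y \near (x : 'rV[R]_n),
  forall i : 'I_n, a ord0 i < (y : 'rV[R]_n) ord0 i < b ord0 i by [].
apply: (@filter_forall _ 'I_n (fun i => [set y : 'rV[R]_n |
  a ord0 i < y ord0 i < b ord0 i]) (nbhs x) _) => i.
have /andP[ax xb] := xab i.
have cx := @coord_continuous R 1 n ord0 i x.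
near=> y; apply/andP; split; near: y.
  exact: (cvgr_gt _ cx).
exact: (cvgr_lt _ cx).
Unshelve. all: by end_near. Qed.

Lemma open_borel A : open A -> measurable (A : set (borel R n)).
Proof. by move=> oA; exact: sub_sigma_algebra. Qed.

Lemma closed_borel A : closed A -> measurable (A : set (borel R n)).
Proof.
move=> cA; rewrite -(setCK A); apply: measurableC.
by apply: open_borel; exact: closed_openC.
Qed.

Lemma compact_coord_cube r :
  compact [set x : 'rV[R]_n | forall i, `|x ord0 i| <= r].
Proof.
rewrite (_ : mkset _ = [set x : 'rV[R]_n | forall i, `[- r, r]%classic (x ord0 i)]).
  by apply: (@rV_compact R n (fun=> `[- r, r]%classic)) => i; exact: segment_compact.
by apply/seteqP; split => x xr i; have := xr i; rewrite /= in_itv/= ler_norml.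
Qed.

(** Each box of an almost optimal cover is dilated by 1 + d about its upper
    corner, which makes it a neighbourhood of the half-open box at the price of
    a factor (1 + d)^n.  Empty boxes are discarded, since a dilation does not
    enlarge them. *)
Lemma lebesgue_outer_regular A e : (lebesgue A < +oo)%E -> 0 < e ->
  exists O, [/\ open O, A `<=` O & (lebesgue O <= lebesgue A + e%:E)%E].
Proof.
move=> Aoo e0.
have Afin : lebesgue A \is a fin_num by rewrite ge0_fin_numE ?lebesgue_ge0.
have e20 : 0 < e / 2 by rewrite divr_gt0.
have [|[D ab] AF Fe] := @lebesgue_adherent R n A (e / 2) e20.
  by rewrite lt_eqF.
move: Fe; rewrite -(fineK Afin) -!EFinD; set c := fine _ => Fe.
have [d d0 dc] : exists2 d, 0 < d & (1 + d) ^+ n * (c + e / 2) <= c + e.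
  have : (fun d : R => (1 + d) ^+ n * (c + e / 2)) @ 0^'+ --> (1 + 0) ^+ n * (c + e / 2).
    apply: cvgM; last exact: cvg_cst.
    apply: (@cvg_comp _ _ _ (fun d : R => 1 + d) (fun x => x ^+ n) _ (nbhs (1 + 0 : R))).
      by apply: cvgD; [exact: cvg_cst|exact: cvg_within].
    exact: exprn_continuous.
  rewrite addr0 expr1n mul1r => /cvgr_lt/(_ (c + e)) h.
  have /h hd : c + e / 2 < c + e by lra.
  near ((0 : R)^'+) => d.
  exists d; first by near: d; exact: nbhs_right_gt.
  by apply/ltW; near: d.
pose F k := ((1 + d) *: (ab k).1 - d *: (ab k).2, (1 + d) *: (ab k).2 - d *: (ab k).2).
pose G k := [set x : 'rV[R]_n | forall i, (F k).1 ord0 i < x ord0 i < (F k).2 ord0 i].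
pose D' := D `&` [set k | box (ab k).1 (ab k).2 !=set0].
exists (\bigcup_(k in D') G k); split.
- by apply: bigcup_open => k _; exact: open_coord_box.
- move=> x /AF[k Dk xk]; exists k; first by split => //; exists x.
  move=> i; rewrite /F /= !mxE; have /andP[ax xb] := xk i.
  have : 0 < d * ((ab k).2 ord0 i - (ab k).1 ord0 i).
    by rewrite mulr_gt0// subr_gt0 (le_lt_trans ax).
  by move=> ?; apply/andP; split; lra.
- apply: (@le_trans _ _ (cover_vol (D, F))).
    apply: ereal_inf_lbound; exists (D, F) => //= x [k [Dk _] xk]; exists k => //= i.
    by have /andP[/ltW -> ->] := xk i.
  rewrite /cover_vol/=.
  apply: (@le_trans _ _ (\esum_(k in D) ((1 + d) ^+ n * box_vol (ab k).1 (ab k).2)%:E)%E).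
    by apply: le_esum => k _; rewrite lee_fin box_vol_affine// addr_ge0// ltW.
  apply: (le_trans (esumZl_le _ _ _)).
  + by rewrite exprn_ge0// addr_ge0// ltW.
  + by move=> k; exact: box_vol_ge0.
  + apply: (@le_trans _ _ (((1 + d) ^+ n)%:E * (c + e / 2)%:E)%E).
      by apply: lee_wpmul2l => //; rewrite lee_fin exprn_ge0// addr_ge0// ltW.
    by rewrite -EFinM lee_fin.
Unshelve. all: by end_near. Qed.

(** Outer regularity of the complement of E in a large cube. *)
Lemma lebesgue_inner_regular (E : set (borel R n)) r e : measurable E ->
    (forall x : 'rV[R]_n, E x -> forall i, `|x ord0 i| <= r) -> 0 < e ->
  exists K : set 'rV[R]_n, [/\ compact K, K `<=` E & (lebesgue (E `\` K) <= e%:E)%E].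
Proof.
move=> mE Er e0; pose Q := [set x : 'rV[R]_n | forall i, `|x ord0 i| <= r].
have kQ : compact Q by exact: compact_coord_cube.
have cQ : closed Q by apply: compact_closed => //; exact: norm_hausdorff.
pose D : set (borel R n) := Q `\` E.
have mD : measurable D by apply: measurableD => //; exact: closed_borel.
have Dfin : (leb D < +oo)%E by apply: (@lebesgue_bounded_lty _ _ _ r) => x [].
have [U [oU DU Ue]] := lebesgue_outer_regular Dfin e0.
have cQU : closed (Q `\` U) by apply: closedI => //; exact: open_closedC.
exists (Q `\` U); split.
- by apply: (subclosed_compact cQU kQ) => x [].
- move=> x [Qx nUx]; apply: contrapT => Ex; exact/nUx/DU.
- apply: (@le_trans _ _ (leb (U `\` D))).
    apply: le_lebesgue => x [Ex nx]; split; last by case.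
    by apply: contrapT => nUx; apply: nx; split => //; exact: Er.
  have mU : measurable (U : set (borel R n)) by exact: open_borel.
  rewrite measureD//; last by rewrite (le_lt_trans Ue)// lte_add_pinfty// ltry.
  rewrite setIidr// leeBlDr ?ge0_fin_numE ?lebesgue_ge0//.
  by rewrite addeC.
Qed.

End lebesgue_regular.

(** * The Legendre transform over a bounded set *)

Section legendre.
Context {R : realType} {n : nat}.
Implicit Types (S : set 'rV[R]_n) (s M r : R) (p q x y : 'rV[R]_n).
Implicit Types (v w : 'rV[R]_n -> R).

Lemma continuous_borel_fun (f : 'rV[R]_n -> R) :
  continuous f -> measurable_fun setT (f : borel R n -> R).
Proof.
move=> /continuousP cf; apply: (measurability _ (RGenOpens.measurableE R)).
move=> _ [_ [a [b ->] <-]]; rewrite setTI.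
by apply: open_borel; apply: cf; exact: interval_open.
Qed.

Lemma continuous_borel_map (f : 'rV[R]_n -> 'rV[R]_n) :
  continuous f -> measurable_fun setT (f : borel R n -> borel R n).
Proof.
move=> /continuousP cf; apply: (@measurability _ _ (borel R n) (borel R n) setT f
  (@open 'rV[R]_n)) => //.
by move=> _ [A oA <-]; rewrite setTI; apply: open_borel; exact: cf.
Qed.

Lemma dotpDl p q y : dotp (p + q) y = dotp p y + dotp q y.
Proof. by rewrite /dotp -big_split/=; apply: eq_bigr => i _; rewrite !mxE mulrDl. Qed.

Lemma dotpDr p x y : dotp p (x + y) = dotp p x + dotp p y.
Proof. by rewrite /dotp -big_split/=; apply: eq_bigr => i _; rewrite !mxE mulrDr. Qed.

Lemma dotpZl s p y : dotp (s *: p) y = s * dotp p y.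
Proof. by rewrite /dotp mulr_sumr; apply: eq_bigr => i _; rewrite !mxE mulrA. Qed.

Lemma dotpZr s p y : dotp p (s *: y) = s * dotp p y.
Proof. by rewrite /dotp mulr_sumr; apply: eq_bigr => i _; rewrite !mxE mulrCA. Qed.

Lemma dotpNl p y : dotp (- p) y = - dotp p y.
Proof. by rewrite -scaleN1r dotpZl mulN1r. Qed.

Lemma dotpNr p y : dotp p (- y) = - dotp p y.
Proof. by rewrite -scaleN1r dotpZr mulN1r. Qed.

Lemma dotp_delta (i : 'I_n) y : dotp (delta_mx ord0 i) y = y ord0 i.
Proof.
rewrite /dotp (bigD1 i)//= mxE !eqxx mul1r big1 ?addr0// => j ji.
by rewrite mxE (negbTE ji) andbF mul0r.
Qed.

Lemma dotpC p y : dotp p y = dotp y p.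
Proof. by apply: eq_bigr => i _; rewrite mulrC. Qed.

Lemma cvg_sum_real {T : Type} (F : set_system T) {FF : Filter F}
    (f : 'I_n -> T -> R) (a : 'I_n -> R) :
  (forall i, f i @ F --> a i) -> (fun t => \sum_i f i t) @ F --> \sum_i a i.
Proof.
move=> fa; elim: (index_enum _) => [|i s IH].
  by rewrite big_nil; under eq_cvg do rewrite big_nil; exact: cvg_cst.
rewrite big_cons; under eq_cvg do rewrite big_cons.
by apply: cvgD => //; exact: fa.
Qed.

Lemma continuous_dotp p : continuous (dotp p).
Proof.
move=> x; apply: (@cvg_sum_real _ (nbhs x) (nbhs_filter x)) => i.
by apply: cvgM; [exact: cvg_cst|exact: coord_continuous].
Qed.

Lemma dotp_le p y r : (forall i, `|y ord0 i| <= r) ->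
  dotp p y <= \sum_i `|p ord0 i| * r.
Proof.
move=> yr; apply: ler_sum => i _; rewrite (le_trans (ler_norm _))// normrM.
by rewrite ler_wpM2l.
Qed.

Definition legendre S v p : R := sup [set dotp p y - v y | y in S].

Definition coord_bounded S r := forall y, S y -> forall i, `|y ord0 i| <= r.

Section legendre_bounded.
Variables (S : set 'rV[R]_n) (v : 'rV[R]_n -> R) (r M : R).
Hypotheses (S0 : S !=set0) (Sr : coord_bounded S r)
  (vM : forall y, S y -> - M <= v y).

Lemma legendre_ub p y : S y -> dotp p y - v y <= legendre S v p.
Proof.
move=> Sy; apply: ub_le_sup; last by exists y.
exists (\sum_i `|p ord0 i| * r + M) => _ [z Sz <-].
by rewrite lerD ?dotp_le//; [exact: Sr|rewrite lerNl vM].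
Qed.

Lemma legendre_le p (c : R) :
  (forall y, S y -> dotp p y - v y <= c) -> legendre S v p <= c.
Proof.
by move=> h; apply: ge_sup => [|_ [y Sy <-]]; [exact: image_nonempty|exact: h].
Qed.

(** A maximum of affine functions of p whose slopes are bounded is Lipschitz. *)
Lemma legendre_lip p q :
  legendre S v p <= legendre S v q + \sum_i `|(p - q) ord0 i| * r.
Proof.
apply: legendre_le => y Sy; have := legendre_ub q Sy.
have := @dotp_le (p - q) y r (Sr Sy); rewrite dotpDl dotpNl; lra.
Qed.

Lemma continuous_legendre : continuous (legendre S v).
Proof.
move=> p; apply/(@cvgrPdist_lt _ _ _ (nbhs p) (nbhs_filter p)) => e e0.
have ci i : (fun q : 'rV[R]_n => `|(p - q) ord0 i| * r) @ p --> (0 : R).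
  have pi : (fun q : 'rV[R]_n => (p - q) ord0 i) @ p --> ((p - p) ord0 i : R).
    apply: (@cvg_comp _ _ _ (fun q : 'rV[R]_n => p - q)
      (fun M : 'rV[R]_n => M ord0 i) (nbhs p) (nbhs (p - p))).
      by apply: (@cvgB _ _ _ (nbhs p) (nbhs_filter p)); [exact: cvg_cst|exact: cvg_id].
    exact: coord_continuous.
  rewrite subrr mxE in pi; rewrite -(mul0r r) -(@normr0 R R).
  by apply: (@cvgM _ _ (nbhs p) (nbhs_filter p)); [exact: cvg_norm|exact: cvg_cst].
have cs : (fun q : 'rV[R]_n => \sum_i `|(p - q) ord0 i| * r) @ p --> (0 : R).
  rewrite [X in _ --> X](_ : _ = \sum_(i < n) (0 : R)); last by rewrite big1.
  exact: (@cvg_sum_real _ (nbhs p) (nbhs_filter p)).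
near=> q.
have : \sum_i `|(p - q) ord0 i| * r < e by near: q; exact: (cvgr_lt _ cs).
have := legendre_lip p q; have := legendre_lip q p.
rewrite (_ : \sum_i `|(q - p) ord0 i| * r = \sum_i `|(p - q) ord0 i| * r); last first.
  by apply: eq_bigr => i _; rewrite !mxE distrC.
by move=> *; rewrite ltr_norml; apply/andP; split; lra.
Unshelve. all: by end_near. Qed.

End legendre_bounded.

Lemma legendreZ S v r M s p : S !=set0 -> coord_bounded S r ->
    (forall y, S y -> - M <= v y) -> 0 < s ->
  legendre S (fun y => s * v y) (s *: p) = s * legendre S v p.
Proof.
move=> S0 Sr vM s0; apply/eqP; rewrite eq_le; apply/andP; split.
  apply: legendre_le => // y Sy; rewrite dotpZl -mulrBr ler_pM2l//.
  exact: legendre_ub Sr vM _ _ Sy.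
rewrite -ler_pdivlMl//; apply: legendre_le => // y Sy.
rewrite ler_pdivlMl// mulrBr -dotpZl.
apply: (@legendre_ub S (fun y => s * v y) r (s * M)) => // z Sz.
by rewrite -mulrN ler_pM2l// vM.
Qed.

Lemma legendre_max S v p : S !=set0 -> compact S -> continuous v ->
  exists2 y, S y & forall z, S z -> dotp p z - v z <= dotp p y - v y.
Proof.
move=> S0 cS cv.
have [|y yS yM] := @compact_EVT_max _ _ (fun y => dotp p y - v y) S S0 cS.
  apply: continuous_subspaceT => y.
  apply: (@cvgB _ _ _ (nbhs y) (nbhs_filter y) (dotp p) v _ _ _ (cv y)).
  exact: continuous_dotp.
by exists y => [|z Sz]; [rewrite -inE|apply: yM; rewrite inE].
Qed.

Lemma compact_coord_bounded S : compact S -> exists2 r, 0 < r & coord_bounded S r.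
Proof.
move=> /compact_bounded[r [rr Sr]].
exists (`|r| + 1); first by rewrite ltr_pwDr.
move=> y Sy i; apply: (le_trans (coord_le_norm y i)); apply: Sr => //.
by rewrite (le_lt_trans (ler_norm _))// ltrDl.
Qed.

Lemma continuous_lower_bound S v : compact S -> continuous v ->
  exists M, forall y, S y -> - M <= v y.
Proof.
move=> cS cv; have [S0|/set0P/negP] := pselect (S !=set0); last first.
  by rewrite negbK => /eqP ->; exists 0.
have [y _ yM] := @legendre_max S v 0 S0 cS cv.
exists (- v y) => z Sz; have := yM _ Sz.
rewrite opprK /dotp !big1; first lra.
  by move=> i _; rewrite mxE mul0r.
by move=> i _; rewrite mxE mul0r.
Qed.

End legendre.

(** * Null sets *)

Section null_sets.
Context {R : realType} {n : nat}.
Implicit Types (A B S : set 'rV[R]_n) (p q x y : 'rV[R]_n).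
Local Notation leb := (lebesgue : set (borel R n) -> \bar R).

Lemma lebesgue_setU_null A B : lebesgue B = 0%E ->
  lebesgue (A `|` B) = lebesgue A.
Proof.
move=> B0; apply/eqP; rewrite eq_le; apply/andP; split.
  by rewrite -[leRHS]adde0 -B0; exact: (outer_measureU2 lebesgue A B).
by apply: le_lebesgue => x; left.
Qed.

Lemma lebesgue_bigcup_null (T : countType) (F : T -> set 'rV[R]_n) :
  (forall t, lebesgue (F t) = 0%E) -> lebesgue (\bigcup_t F t) = 0%E.
Proof.
move=> F0; pose G k := oapp F set0 (unpickle k).
apply/eqP; rewrite eq_le lebesgue_ge0 andbT.
apply: (@le_trans _ _ (lebesgue (\bigcup_k G k))).
  apply: le_lebesgue => x [t _ xt]; exists (pickle t) => //.
  by rewrite /G pickleK.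
apply: le_trans (lebesgue_sigma_subadditive _) _.
rewrite eseries0// => k _ _; rewrite /G; case: unpickle => [t|]/=.
  exact: F0.
exact: lebesgue0.
Qed.

Lemma lebesgue_translate A v : lebesgue [set (x + v)%R | x in A] = lebesgue A.
Proof.
rewrite -[RHS]mul1e -(expr1n R n) -(lebesgue_affine _ v)//; congr lebesgue.
by under [RHS]eq_imagel do rewrite scale1r.
Qed.

Lemma continuous_translate (v : 'rV[R]_n) : continuous (fun x => x - v).
Proof.
move=> x; apply: (@cvgB _ _ _ (nbhs x) (nbhs_filter x)).
  exact: cvg_id.
exact: cvg_cst.
Qed.

(** If every line in the direction e_i meets A at most once, the translates of
    A along e_i are disjoint.  Infinitely many of them, cut off by a cube, fit
    into a bounded set, so that A is null.  This replaces Fubini's theorem. *)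
Lemma null_of_line_singletons A (i : 'I_n) : closed A ->
    (forall p (s : R), 0 < s -> A p -> ~ A (p + s *: delta_mx ord0 i)) ->
  lebesgue A = 0%E.
Proof.
move=> cA Aline.
pose Q (k : nat) := [set x : 'rV[R]_n | forall i, `|x ord0 i| <= k%:R].
rewrite (_ : A = \bigcup_k (A `&` Q k)); last first.
  apply/seteqP; split => [x Ax|x [k _ []]//].
  exists (Num.bound `|x|) => //; split => // j.
  by apply: (le_trans (coord_le_norm x j)); exact/ltW/archi_boundP.
apply: lebesgue_bigcup_null => k; set B := A `&` Q k.
have cB : closed B.
  apply: closedI => //; apply: compact_closed; first exact: norm_hausdorff.
  exact: compact_coord_cube.
pose e (m : nat) : 'rV[R]_n := m.+1%:R^-1 *: delta_mx ord0 i.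
pose F m := [set x + e m | x in B].
have mF m : measurable (F m : set (borel R n)).
  rewrite /F (_ : image _ _ = (fun x => x - e m) @^-1` B).
    apply: closed_borel; apply: closed_comp => // x _.
    exact: continuous_translate.
  apply/seteqP; split => [_ [x Bx <-] /=|x /= Bx]; first by rewrite addrK.
  by exists (x - e m) => //; rewrite subrK.
have FE m : lebesgue (F m) = lebesgue B by exact: lebesgue_translate.
have sh (m l : nat) x y : (m < l)%N -> A x -> A y -> x + e m = y + e l -> False.
  move=> ml Ax Ay exy.
  have s0 : 0 < m.+1%:R^-1 - l.+1%:R^-1 :> R.
    by rewrite subr_gt0 ltf_pV2 ?posrE ?ltr0n// ltr_nat.
  apply: (Aline x _ s0 Ax); rewrite (_ : _ + _ = y)//.
  by rewrite scalerBl addrA -/(e m) -/(e l) exy addrK.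
have tF : trivIset setT F.
  apply/trivIsetP => m l _ _ ml; apply/seteqP; split => // z [[x [Bx _] <-] [y [By _] exy]].
  have [lm|lm|lm] := ltngtP m l.
  - exact: (sh _ _ _ _ lm Bx By).
  - exact: (sh _ _ _ _ lm By Bx).
  - by rewrite lm eqxx in ml.
have Bbig N : (N%:R%:E * lebesgue B <= lebesgue (Q k.+1))%E.
  have := @measure_bigsetU _ _ _ leb F mF tF N.
  rewrite (eq_bigr (fun=> lebesgue B)) => [|m _]; last exact: FE.
  rewrite sumr_const card_ord => h. rewrite mule_natl.
  apply: (@le_trans _ _ (leb (\big[setU/set0]_(i < N) F i))); first by rewrite h.
  apply: le_lebesgue => z; rewrite -bigcup_mkord => -[m _ [x [_ Qx] <-]] j.
  rewrite !mxE -[k.+1%:R]natr1 (le_trans (ler_normD _ _))// lerD// normrM.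
  rewrite ger0_norm ?invr_ge0// eqxx/=.
  case: (j == i); rewrite ?normr0 ?mulr0// normr1 mulr1 invf_le1 ?ltr0n//.
  by rewrite ler1n.
have Bfin : (lebesgue B < +oo)%E by apply: (@lebesgue_bounded_lty _ _ _ k%:R) => x [].
have Qfin : (lebesgue (Q k.+1) < +oo)%E by exact: (@lebesgue_bounded_lty _ _ _ k.+1%:R).
move: Bbig; rewrite -(@fineK _ (lebesgue B)) ?ge0_fin_numE ?lebesgue_ge0//.
rewrite -(@fineK _ (lebesgue (Q _))) ?ge0_fin_numE ?lebesgue_ge0//.
have b0 : 0 <= fine (lebesgue B) by rewrite fine_ge0// lebesgue_ge0.
have d0 : 0 <= fine (lebesgue (Q k.+1)) by rewrite fine_ge0// lebesgue_ge0.
move: b0 d0; set b := fine (lebesgue B); set d := fine _ => b0 d0 h.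
congr (_%:E); apply/eqP; rewrite eq_le b0 andbT leNgt.
apply/negP => bp; have := h (Num.bound (d / b)); rewrite -EFinM lee_fin leNgt => /negP; apply.
by rewrite -ltr_pdivrMr//; apply: archi_boundP; rewrite divr_ge0.
Qed.

End null_sets.

(** * The contact map and the Monge-Ampere measure *)

Section contact.
Context {R : realType} {n : nat}.
Variables (Omega : set 'rV[R]_n) (w : 'rV[R]_n -> R).
Implicit Types (C : set 'rV[R]_n) (p q x y z : 'rV[R]_n).
Hypotheses (Omega0 : Omega !=set0) (kOmega : compact (closure Omega))
  (cw : continuous w).
Local Notation S := (closure Omega).
Local Notation leb := (lebesgue : set (borel R n) -> \bar R).

Definition maximizer p y := S y /\ forall z, S z -> dotp p z - w z <= dotp p y - w y.

Definition contact C : set 'rV[R]_n := [set p | exists2 y, C y & maximizer p y].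

Let S0 : S !=set0.
Proof. by have [x Ox] := Omega0; exists x; exact: subset_closure. Qed.

Lemma legendre_maximizer p y : maximizer p y -> legendre S w p = dotp p y - w y.
Proof.
move=> [Sy My]; have [r r0 Sr] := compact_coord_bounded kOmega.
have [M SM] := continuous_lower_bound kOmega cw.
apply/eqP; rewrite eq_le (legendre_ub Sr SM _ Sy) andbT.
exact: legendre_le.
Qed.

Lemma maximizer_exists p : exists y, maximizer p y.
Proof. by have [y Sy My] := legendre_max p S0 kOmega cw; exists y. Qed.

(** Slopes that touch above C are those at which the maximum over C equals the
    maximum over the closure of Omega; both depend continuously on the slope. *)
Lemma closed_contact C : closed C -> closed (contact C).
Proof.
move=> cC; pose D := C `&` S.
have kD : compact D.
  apply: (subclosed_compact _ kOmega); last by move=> x [].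
  by apply: closedI => //; exact: closed_closure.
have [D0|nD0] := pselect (D !=set0); last first.
  rewrite (_ : contact C = set0); first exact: closed0.
  by apply/seteqP; split => // p [y Cy [Sy _]]; apply: nD0; exists y.
have [r r0 Sr] := compact_coord_bounded kOmega.
have [M SM] := continuous_lower_bound kOmega cw.
have Dr : coord_bounded D r by move=> y [_ /Sr].
have DM y : D y -> - M <= w y by move=> [_ /SM].
have cS := continuous_legendre S0 Sr SM.
have cD := continuous_legendre D0 Dr DM.
rewrite (_ : contact C = (fun p => legendre D w p - legendre S w p) @^-1` [set t | 0 <= t]).
  apply: closed_comp; last exact: closed_ge.
  by move=> p _; apply: (@cvgB _ _ _ (nbhs p) (nbhs_filter p)); [exact: cD|exact: cS].
apply/seteqP; split => [p [y Cy My]|p /=]; rewrite /= subr_ge0.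
  by rewrite (legendre_maximizer My); apply: (legendre_ub Dr DM); split => //; exact: My.1.
move=> DS; have [y [Cy Sy] My] := legendre_max p D0 kD cw.
exists y => //; split => // z Sz; apply: le_trans (legendre_ub Sr SM p Sz) _.
by apply: (le_trans DS); exact: legendre_le.
Qed.

Lemma maximizer_monotone p q y z : maximizer p y -> maximizer q z ->
  0 <= dotp (p - q) (y - z).
Proof.
move=> [Sy My] [Sz Mz]; have := My _ Sz; have := Mz _ Sy.
rewrite dotpDl dotpNl !dotpDr !dotpNr; lra.
Qed.

(** The boundary competes in the definition of a maximizer but not in that of
    the subdifferential; by continuity this makes no difference. *)
Lemma maximizer_closure p y : S y ->
  (forall z, Omega z -> dotp p z - w z <= dotp p y - w y) -> maximizer p y.
Proof.
move=> Sy My; split => // z.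
have cl : closed [set z | dotp p z - w z <= dotp p y - w y].
  apply: (@closed_comp _ _ (fun z => dotp p z - w z) [set t | t <= dotp p y - w y]).
    move=> x _; apply: (@cvgB _ _ _ (nbhs x) (nbhs_filter x)); last exact: cw.
    exact: continuous_dotp.
  exact: closed_le.
by move=> /(closureS My) /cl.
Qed.

Lemma subdifferential_contact C :
  \bigcup_(x in C `&` Omega) subdifferential Omega w x = contact (C `&` Omega).
Proof.
apply/seteqP; split => p.
  move=> [y [Cy Oy] py]; exists y => //; apply: maximizer_closure.
    exact: subset_closure.
  by move=> z /py; rewrite dotpDr dotpNr; lra.
move=> [y [Cy Oy] [Sy My]]; exists y => // z Oz.
by have := My z (subset_closure Oz); rewrite dotpDr dotpNr; lra.
Qed.

(** The slopes at which L w is not differentiable. *)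
Definition multiple_contact : set 'rV[R]_n :=
  [set p | exists y z, [/\ maximizer p y, maximizer p z & y != z]].

Let slab (t : 'I_n * (rat * rat)) : set 'rV[R]_n :=
  if t.2.1 < t.2.2 then
    contact [set y | y ord0 t.1 <= ratr t.2.1] `&`
    contact [set y | ratr t.2.2 <= y ord0 t.1]
  else set0.

Let closed_slab t : closed (slab t).
Proof.
rewrite /slab; case: ifP => _; last exact: closed0.
apply: closedI; apply: closed_contact.
  apply: (@closed_comp _ _ (fun y : 'rV[R]_n => y ord0 t.1) [set s | s <= ratr t.2.1]).
    by move=> x _; exact: coord_continuous.
  exact: closed_le.
apply: (@closed_comp _ _ (fun y : 'rV[R]_n => y ord0 t.1) [set s | ratr t.2.2 <= s]).
  by move=> x _; exact: coord_continuous.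
exact: closed_ge.
Qed.

Let multiple_contact_slab : multiple_contact = \bigcup_t slab t.
Proof.
apply/seteqP; split => p; last first.
  move=> [[i [a b]] _]; rewrite /slab/=; case: ifPn => // ab [[y ya My] [z zb Mz]].
  exists y, z; split => //; apply/eqP => yz; move: ya zb; rewrite yz /= => za bz.
  by have := le_trans bz za; rewrite ler_rat leNgt ab.
move=> [y [z [My Mz yz]]].
have [i yzi] : exists i, y ord0 i != z ord0 i.
  apply/existsP; apply: contraNT yz => /existsPn yz.
  by apply/eqP/rowP => i; apply/eqP; have := yz i; rewrite negbK.
wlog : y z My Mz yz yzi / y ord0 i < z ord0 i.
  move=> h; have [yzlt|zy|yze] := ltgtP (y ord0 i) (z ord0 i).
  - exact: (h y z).
  - by apply: (h z y) => //; rewrite eq_sym.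
  - by rewrite yze eqxx in yzi.
move=> lt; have [a] := rat_in_itvoo lt; rewrite in_itv/= => /andP[ya az].
have [b] := rat_in_itvoo az; rewrite in_itv/= => /andP[ab zb].
exists (i, (a, b)) => //; rewrite /slab/=; rewrite ltr_rat in ab; rewrite ab.
by split; [exists y => //; exact: ltW ya|exists z => //; exact: ltW zb].
Qed.

(** Two distinct maximizers are separated by a slab a < y_i < b with a, b
    rational.  By monotonicity, moving the slope by s e_i with s > 0 moves every
    maximizer beyond b, so each line in the direction e_i contains at most one
    slope with maximizers on both sides of that slab. *)
Lemma multiple_contact_null : lebesgue multiple_contact = 0%E.
Proof.
rewrite multiple_contact_slab; apply: lebesgue_bigcup_null => -[i [a b]].
apply: (@null_of_line_singletons _ _ _ i); first exact: closed_slab.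
rewrite /slab/=; case: ifP => // ab p s s0 [_ [y /= yb My]] [[z /= za Mz] _].
have := maximizer_monotone Mz My.
rewrite addrC addKr dotpZl pmulr_rge0// dotp_delta !mxE subr_ge0 leNgt => /negP; apply.
by apply: (le_lt_trans za); rewrite (lt_le_trans _ yb)// ltr_rat.
Qed.

Lemma measurable_multiple_contact : measurable (multiple_contact : set (borel R n)).
Proof.
rewrite multiple_contact_slab; apply: countable_bigcupT_measurable.
  exact: countableP.
by move=> t; apply: closed_borel; exact: closed_slab.
Qed.

(** The gradient of L w where it exists.  The value 0 on the null set of
    multiple contacts makes this map Borel measurable, without completing the
    sigma-algebra. *)
Definition contact_point (p : borel R n) : borel R n :=
  if pselect (multiple_contact p) then 0 else xget 0 [set y | maximizer p y].

Lemma contact_pointP p : ~ multiple_contact p -> maximizer p (contact_point p).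
Proof.
move=> Np; rewrite /contact_point; case: pselect => [/Np //|nN /=].
have [y My] := maximizer_exists p.
by apply: (@xgetPex _ 0 [set y | maximizer p y]); exists y.
Qed.

Lemma contact_point_multiple p : multiple_contact p -> contact_point p = 0.
Proof. by rewrite /contact_point; case: pselect. Qed.

Lemma contact_point_unique p y : ~ multiple_contact p -> maximizer p y ->
  contact_point p = y.
Proof.
move=> Np My; apply: contrapT => /eqP ne; apply: (Np).
by exists (contact_point p), y; split => //; exact: contact_pointP.
Qed.

Lemma measurable_contact_point : measurable_fun setT contact_point.
Proof.
have mC C : closed C -> measurable (contact_point @^-1` (C : set (borel R n))).
  move=> cC; rewrite (_ : _ @^-1` _ =
    ((contact C : set (borel R n)) `\` multiple_contact) `|`
    (multiple_contact `&` (if pselect (C 0) then setT else set0))).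
    have mN := measurable_multiple_contact.
    apply: measurableU; [apply: measurableD => //|apply: measurableI => //].
      by apply: closed_borel; exact: closed_contact.
    by case: pselect => _ /=; [exact: measurableT|exact: measurable0].
  apply/seteqP; split => p /=.
    have [Np|Np] := pselect (multiple_contact p).
      by rewrite contact_point_multiple// => C0; right; split => //; case: pselect => //=.
    by move=> Cp; left; split => //; exists (contact_point p) => //; exact: contact_pointP.
  case=> [[[y Cy My] Np]|[Np]]; first by rewrite (contact_point_unique Np My).
  by rewrite contact_point_multiple//; case: pselect => //=.
apply: (@measurability _ _ (borel R n) (borel R n) setT contact_point (@open 'rV[R]_n)) => //.
move=> _ [A oA <-]; rewrite setTI -(setCK A) preimage_setC.
by apply: measurableC; exact: (mC (~` A) (open_closedC oA)).
Qed.

(** The contact map sends almost all slopes in the subdifferentials over E into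
    E.  As a consequence the Monge-Ampere set function is a measure. *)
Lemma monge_ampere_pushforward (E : set (borel R n)) :
  monge_ampere Omega w E = leb (contact_point @^-1` (E `&` Omega)).
Proof.
rewrite /monge_ampere subdifferential_contact.
rewrite -[RHS](lebesgue_setU_null _ multiple_contact_null).
rewrite -[LHS](lebesgue_setU_null _ multiple_contact_null); congr lebesgue.
apply/seteqP; split => p [|Np]; try by right.
  move=> [y EOy My]; have [|Np] := pselect (multiple_contact p); first by right.
  by left; rewrite /= (contact_point_unique Np My).
move=> EOp; have [|Np] := pselect (multiple_contact p); first by right.
by left; exists (contact_point p) => //; exact: contact_pointP.
Qed.

End contact.

(** * The energy as the integral of a gap of Legendre transforms *)

Section dilation.
Context {R : realType} {n : nat}.
Local Notation leb := (lebesgue : set (borel R n) -> \bar R).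

Lemma measurable_dilation (s : R) :
  measurable_fun setT ((fun x => s *: x) : borel R n -> borel R n).
Proof. by apply: continuous_borel_map => x; exact: scaler_continuous. Qed.

Lemma ge0_integral_dilation (s : R) (D : set (borel R n)) (f : borel R n -> \bar R) :
    0 < s -> measurable D -> measurable_fun D f -> (forall x, D x -> (0 <= f x)%E) ->
  (\int[leb]_(x in ((fun x => s *: x) : borel R n -> borel R n) @^-1` D) f (s *: x)%R =
   (s^-1 ^+ n)%:E * \int[leb]_(x in D) f x)%E.
Proof.
move=> s0 mD mf f0; have si : 0 < s^-1 by rewrite invr_gt0.
pose phi : borel R n -> borel R n := fun x => s *: x.
have mphi : measurable_fun setT phi by exact: measurable_dilation.
have k0 : 0 <= s^-1 ^+ n by rewrite exprn_ge0// ltW.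
transitivity (\int[pushforward leb phi]_(x in D) f x)%E.
  by rewrite ge0_integral_pushforward// => x; rewrite inE; exact: f0.
rewrite -(@ge0_integral_mscale _ _ _ leb D mD (NngNum k0))//.
apply: eq_measure_integral => A mA AD; rewrite /pushforward /mscale/=.
transitivity ((s^-1 ^+ n)%:E * lebesgue A)%E; last by [].
rewrite -(lebesgue_affine _ 0)//; congr lebesgue.
apply/seteqP; split => [x Ax|_ [y Ay <-]] /=.
  by exists (s *: x) => //; rewrite scalerA mulVf ?gt_eqF// scale1r addr0.
by rewrite /phi addr0 scalerA mulfV ?gt_eqF// scale1r.
Qed.

End dilation.

Section bernoulli.
Context {R : realType}.
Implicit Types (s a b : R) (n : nat).

Lemma exprn_sub1_ge s n : 1 <= s -> n.+1%:R * (s - 1) <= s ^+ n.+1 - 1.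
Proof.
move=> s1; rewrite subrX1 mulrC ler_wpM2l ?subr_ge0//.
rewrite -[n.+1 in leLHS](card_ord n.+1) -sumr_const; apply: ler_sum => i _.
by rewrite exprn_ege1.
Qed.

Lemma exprn_sub1_le s n : 1 <= s -> s ^+ n.+1 - 1 <= n.+1%:R * s ^+ n * (s - 1).
Proof.
move=> s1; rewrite subrX1 mulrC ler_wpM2r ?subr_ge0//.
rewrite mulr_natl -[n.+1 in leRHS](card_ord n.+1) -sumr_const; apply: ler_sum => i _.
by rewrite ler_weXn2l// -ltnS.
Qed.

Lemma le_of_le_exprn a b n : (forall s, 1 < s -> a <= s ^+ n * b) -> a <= b.
Proof.
move=> h; have cX : (fun s => s ^+ n * b) @ (1 : R)^'+ --> b.
  suff : (fun s => s ^+ n * b) @ (1 : R)^'+ --> 1 ^+ n * b by rewrite expr1n mul1r.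
  apply: cvgM; last exact: cvg_cst.
  apply: cvg_at_right_filter; exact: exprn_continuous.
rewrite -(cvg_lim (@Rhausdorff R) cX); apply: limr_ge; first by apply/cvg_ex; exists b.
near=> s; apply: h; near: s; exact: nbhs_right_gt.
Unshelve. all: by end_near. Qed.

Lemma expr_unbounded s b c : 1 < s -> 0 < b -> (forall k, s ^+ k * b <= c) -> False.
Proof.
move=> s1 b0 h; have s10 : 0 < s - 1 by rewrite subr_gt0.
have c0 : 0 <= c by apply: le_trans (h 0%N); rewrite expr0 mul1r ltW.
have := h (Num.bound (c / (b * (s - 1)))).+1; apply/negP; rewrite -ltNge.
set k := Num.bound _.
have kc : c < k%:R * (b * (s - 1)).
  by rewrite -ltr_pdivrMr ?mulr_gt0//; apply: archi_boundP; rewrite divr_ge0// mulr_ge0// ltW.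
apply: (lt_trans kc); rewrite mulrCA mulrC ltr_pM2r//.
apply: (@lt_le_trans _ _ (1 + k.+1%:R * (s - 1))).
  by rewrite -natr1 mulrDl mul1r; lra.
by have := exprn_sub1_ge k (ltW s1); lra.
Qed.

(** The recursion multiplies (n+1) phi k - s^n a by at least s^(n+1) at each
    step.  If this were positive for k = 0, it would outgrow (s^n)^k.  Below,
    phi k is the integral of the gap over a cube of radius s^k r and a is the
    energy. *)
Lemma superhomogeneous_bound (phi : nat -> R) s C a n :
    1 < s -> 0 <= a ->
    (forall k, s * phi k <= s^-1 ^+ n * phi k.+1 + (s - 1) * a) ->
    (forall k, phi k <= C * (s ^+ n) ^+ k) ->
  n.+1%:R * phi 0%N <= s ^+ n * a.
Proof.
move=> s1 a0 rec growth; rewrite -subr_le0 leNgt; apply/negP => psi0.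
have s0 : 0 < s by exact: lt_trans s1.
pose psi k := n.+1%:R * phi k - s ^+ n * a.
have psiS k : s ^+ n.+1 * psi k <= psi k.+1.
  have := ler_wpM2l (ltW (exprn_gt0 n s0)) (rec k).
  rewrite mulrA -exprSr mulrDr mulrA -exprMn mulfV ?gt_eqF// expr1n mul1r => {}h.
  have {}h := ler_wpM2l (ler0n R n.+1) h.
  have ge1 := ler_wpM2r (mulr_ge0 (ltW (exprn_gt0 n s0)) a0) (exprn_sub1_ge n (ltW s1)).
  rewrite /psi; nra.
have psik k : (s ^+ n.+1) ^+ k * psi 0%N <= psi k.
  elim: k => [|k IH]; first by rewrite expr0 mul1r.
  rewrite exprS -mulrA; apply: le_trans (psiS k).
  by rewrite ler_wpM2l// exprn_ge0// ltW.
apply: (@expr_unbounded s (psi 0%N) (n.+1%:R * C)) => // k.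
rewrite -(ler_pM2l (exprn_gt0 k (exprn_gt0 n s0))) mulrA -exprMn -exprSr.
apply: (le_trans (psik k)); rewrite /psi mulrCA [_ ^+ k * C]mulrC.
have := ler_wpM2l (ler0n R n.+1) (growth k).
have := mulr_ge0 (ltW (exprn_gt0 n s0)) a0; lra.
Qed.

End bernoulli.

Section energy_formula.
Context {R : realType} {n : nat}.
Variables (Omega : set 'rV[R]_n) (w : 'rV[R]_n -> R).
Implicit Types (p q x y z : 'rV[R]_n) (s : R).
Hypotheses (Omega0 : Omega !=set0) (kOmega : compact (closure Omega))
  (cw : continuous w) (oOmega : open Omega) 
  (w_le0 : forall x, w x <= 0) (w_out : forall x, ~ Omega x -> w x = 0).
Local Notation S := (closure Omega).
Local Notation leb := (lebesgue : set (borel R n) -> \bar R).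
Local Notation T := (contact_point Omega w).

Definition gap p := legendre S w p - legendre S (fun=> 0) p.

Definition gap_integral := (\int[leb]_p (gap p)%:E)%E.

Let S0 : S !=set0.
Proof. by have [x Ox] := Omega0; exists x; exact: subset_closure. Qed.

Let c0 : continuous (fun=> 0 : R) := @cst_continuous 'rV[R]_n R 0.

(** Change of variables along the contact map. *)
Lemma energyE : energy Omega w = (\int[leb]_p `|w (T p)|%:E)%E.
Proof.
have mT := measurable_contact_point Omega0 kOmega cw.
have mO : measurable (Omega : set (borel R n)) by exact: open_borel.
have mw : measurable_fun setT (fun x : borel R n => `|w x|%:E).
  by apply/measurable_EFinP; apply: measurableT_comp => //; exact: continuous_borel_fun.
rewrite /energy.
rewrite (_ : monge_ampere Omega w = mrestr (pushforward leb T) mO); last first.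
  by apply/funext => E; rewrite (monge_ampere_pushforward Omega0 kOmega cw).
transitivity (\int[pushforward leb T]_(x in (Omega : set (borel R n))) `|w x|%:E)%E.
  apply: eq_measure_integral => A mA /setIidl AO.
  by transitivity (leb (T @^-1` (A `&` Omega))) => //; rewrite AO.
rewrite ge0_integral_pushforward//; last first.
  by apply: measurable_funTS.
rewrite integral_mkcond; apply: eq_integral => p _.
rewrite /patch/=; case: ifPn => //; rewrite notin_setE/= => /w_out ->.
by rewrite normr0.
Qed.

Let bounds : exists r M, [/\ 0 < r, coord_bounded S r, 0 <= M & forall y, - M <= w y].
Proof.
have [r r0 Sr] := compact_coord_bounded kOmega.
have [M SM] := continuous_lower_bound kOmega cw.
exists r, `|M|; split => // y; have [Sy|/w_out ->] := pselect (Omega y).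
  by apply: le_trans (SM _ (subset_closure Sy)); rewrite lerN2 ler_norm.
by rewrite oppr_le0.
Qed.

Lemma continuous_gap : continuous gap.
Proof.
have [r [M [r0 Sr M0 wM]]] := bounds => p.
apply: (@cvgB _ _ _ (nbhs p) (nbhs_filter p)).
  by apply: (continuous_legendre S0 Sr) => y _; exact: wM.
by apply: (continuous_legendre S0 Sr (M := 0)) => y _; rewrite oppr0.
Qed.

Lemma gap_maximizer p y : maximizer Omega w p y ->
  gap p = dotp p y - w y - legendre S (fun=> 0) p.
Proof. by move=> My; rewrite /gap (legendre_maximizer Omega0 kOmega cw My). Qed.

Lemma gap_ge p y : S y -> dotp p y - w y - legendre S (fun=> 0) p <= gap p.
Proof.
have [r [M [r0 Sr M0 wM]]] := bounds => Sy.
by rewrite lerD2r; apply: (legendre_ub Sr) => // z _; exact: wM.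
Qed.

Lemma gap_ge0 p : 0 <= gap p.
Proof.
have [y [Sy My]] := maximizer_exists Omega0 kOmega c0 p.
apply: le_trans (gap_ge p Sy).
rewrite (legendre_maximizer Omega0 kOmega c0 (conj Sy My)).
by have := w_le0 y; lra.
Qed.

Lemma gap_bounded : exists2 M, 0 <= M & forall p, gap p <= M.
Proof.
have [r [M [r0 Sr M0 wM]]] := bounds; exists M => // p.
have [y My] := maximizer_exists Omega0 kOmega cw p.
rewrite (gap_maximizer My).
have : dotp p y - 0 <= legendre S (fun=> 0) p.
  by apply: (legendre_ub (M := 0) Sr) => [z _|]; [rewrite oppr0|exact: My.1].
by have := wM y; lra.
Qed.

Let legendre0Z s p : 0 < s ->
  legendre S (fun=> 0) (s *: p) = s * legendre S (fun=> 0) p.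
Proof.
have [r [M [r0 Sr M0 wM]]] := bounds => s0.
rewrite -(@legendreZ _ _ S (fun=> 0) r 0)//.
by congr legendre; apply/funext => y; rewrite mulr0.
Qed.

(** For fixed p the maximum over y of p.y - s w(y) is a convex function of s
    whose derivative is |w(y)| at the maximizer y.  Here it is compared with its
    tangent at s = 1, and in [gap_dilation_le] with its tangent at s, using
    that L (s w)(p) = s L w (p / s). *)
Lemma gap_dilation_ge s p : 1 < s -> ~ multiple_contact Omega w p ->
  gap p + (s - 1) * `|w (T p)| <= s * gap (s^-1 *: p).
Proof.
have [r [M [r0 Sr M0 wM]]] := bounds => s1 Np; have s0 : 0 < s by exact: lt_trans s1.
have My := contact_pointP Omega0 kOmega cw Np.
rewrite (gap_maximizer My) /gap legendre0Z ?invr_gt0// mulrBr ler0_norm//.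
have := legendre_ub Sr (fun z _ => wM z) (s^-1 *: p) My.1; rewrite dotpZl.
rewrite -(ler_pM2l s0) mulrBr !mulrA mulfV ?gt_eqF// !mul1r; lra.
Qed.

Lemma gap_dilation_le s p : 1 < s -> ~ multiple_contact Omega w p ->
  s * gap p <= gap (s *: p) + (s - 1) * `|w (T p)|.
Proof.
move=> s1 Np; have s0 : 0 < s by exact: lt_trans s1.
have My := contact_pointP Omega0 kOmega cw Np.
rewrite (gap_maximizer My) ler0_norm//.
have := gap_ge (s *: p) My.1; rewrite legendre0Z// dotpZl; nra.
Qed.

Let mgap : measurable_fun setT (fun p : borel R n => (gap p)%:E).
Proof. by apply/measurable_EFinP; apply: continuous_borel_fun; exact: continuous_gap. Qed.

Let mwT : measurable_fun setT (fun p : borel R n => `|w (T p)|%:E).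
Proof.
have mT := measurable_contact_point Omega0 kOmega cw.
apply/measurable_EFinP; apply: measurableT_comp => //.
by apply: measurableT_comp => //; exact: continuous_borel_fun.
Qed.

Lemma gap_integral_ge0 : (0 <= gap_integral)%E.
Proof. by apply: integral_ge0 => p _; rewrite lee_fin gap_ge0. Qed.

Lemma energy_ge0 : (0 <= energy Omega w)%E.
Proof. by rewrite energyE; apply: integral_ge0 => p _; rewrite lee_fin. Qed.

Local Open Scope ereal_scope.

Let energy_dilation s : (1 < s)%R ->
  (gap_integral + (s - 1)%:E * energy Omega w <= (s ^+ n.+1)%:E * gap_integral)%E.
Proof.
move=> s1; have s0 : (0 < s)%R by exact: lt_trans s1.
pose f : borel R n -> \bar R := fun p => (gap p)%:E + (s - 1)%:E * `|w (T p)|%:E.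
have f0 p : 0 <= f p.
  by rewrite adde_ge0 ?mule_ge0 ?lee_fin ?gap_ge0// subr_ge0 ltW.
have mf : measurable_fun setT f by apply: emeasurable_funD => //; exact: measurable_funeM.
rewrite energyE -ge0_integralZl_EFin//; last by rewrite subr_ge0 ltW.
rewrite -ge0_integralD//; last 3 first.
- by move=> p _; rewrite lee_fin gap_ge0.
- by move=> p _; rewrite -EFinM lee_fin mulr_ge0// subr_ge0 ltW.
- exact: measurable_funeM.
have si0 : (0 < s^-1)%R by rewrite invr_gt0.
have := ge0_integral_dilation si0 measurableT mgap.
rewrite preimage_setT invrK => /(_ _)/wrap[p _|h]; first by rewrite lee_fin gap_ge0.
have mgs : measurable_fun setT (fun p : borel R n => (gap (s^-1 *: p)%R)%:E).
  by apply: (measurableT_comp mgap); exact: measurable_dilation.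
rewrite exprS EFinM -muleA -h -ge0_integralZl_EFin//; last 2 first.
- by move=> p _; rewrite lee_fin gap_ge0.
- exact: ltW.
apply: ae_ge0_le_integral => //.
- by move=> p _; exact: f0.
- by move=> p _; rewrite -EFinM lee_fin mulr_ge0 ?gap_ge0// ltW.
- exact: measurable_funeM.
exists (multiple_contact Omega w); split.
- exact: measurable_multiple_contact.
- exact: multiple_contact_null.
- move=> p /= np; apply: contrapT => Np; apply: np => _.
  by rewrite /f -!EFinM -EFinD lee_fin gap_dilation_ge.
Qed.

(** By [energy_dilation], energy <= (s^(n+1) - 1) / (s - 1) * gap_integral for
    all s > 1; let s tend to 1. *)
Lemma energy_le_gap : (energy Omega w <= n.+1%:R%:E * gap_integral)%E.
Proof.
have [->|Goo] := eqVneq gap_integral +oo%E.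
  by rewrite gt0_muley ?leey// lte_fin ltr0n.
have Gf : gap_integral \is a fin_num by rewrite ge0_fin_numE ?gap_integral_ge0// ltey.
have Ef : energy Omega w \is a fin_num.
  rewrite ge0_fin_numE ?energy_ge0//.
  have := @energy_dilation 2; rewrite (_ : 2 - 1 = 1)%R; last by lra.
  rewrite mul1e => /(_ _)/wrap[]; first by lra.
  move=> h; apply: (@le_lt_trans _ _ (gap_integral + energy Omega w)%E).
    by rewrite leeDr// gap_integral_ge0.
  by apply: (le_lt_trans h); rewrite -(fineK Gf) -EFinM ltry.
have := energy_dilation; rewrite -(fineK Gf) -(fineK Ef) => h.
rewrite -EFinM lee_fin; apply: (@le_of_le_exprn _ _ _ n) => s s1.
have := h s s1; rewrite -!EFinM -EFinD lee_fin.
have G0 : (0 <= fine gap_integral)%R by rewrite fine_ge0// gap_integral_ge0.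
have := exprn_sub1_le n (ltW s1); move: (fine _) (fine _) G0 => G E G0 hs hE.
have s10 : (0 < s - 1)%R by rewrite subr_gt0.
rewrite -(ler_pM2l s10).
have := ler_wpM2r G0 hs; lra.
Qed.

(** The tangent inequality is integrated over cubes rather than over R^n,
    since the integral of the gap is not known to be finite beforehand.  On a
    cube the gap is bounded, and [superhomogeneous_bound] applies. *)
Lemma gap_le_energy : n.+1%:R%:E * gap_integral <= energy Omega w.
Proof.
have [->|Eoo] := eqVneq (energy Omega w) +oo%E; first by rewrite leey.
have Ef : energy Omega w \is a fin_num by rewrite ge0_fin_numE ?energy_ge0// ltey.
have [M M0 gM] := gap_bounded.
pose Q (r : R) : set (borel R n) := [set p : 'rV[R]_n | forall i, (`|p ord0 i| <= r)%R].
have mQ r : measurable (Q r).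
  apply: closed_borel; apply: compact_closed; first exact: norm_hausdorff.
  exact: compact_coord_cube.
have Qfin r : leb (Q r) \is a fin_num.
  by rewrite ge0_fin_numE ?lebesgue_ge0//; exact: (@lebesgue_bounded_lty _ _ _ r).
have QZ (s r : R) : (0 < s)%R -> leb (Q (s * r)%R) = (s ^+ n)%:E * leb (Q r).
  move=> s0; transitivity ((s ^+ n)%:E * lebesgue (Q r)); last by [].
  rewrite -(lebesgue_affine _ 0)//; congr lebesgue; apply/seteqP; split.
    move=> p Qp; exists (s^-1 *: p)%R; last by rewrite addr0 scalerA mulfV ?gt_eqF// scale1r.
    move=> i; rewrite mxE normrM gtr0_norm ?invr_gt0// ler_pdivrMl//; exact: Qp.
  move=> _ [p Qp <-] i; rewrite addr0 mxE normrM gtr0_norm// ler_pM2l//.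
pose phi r := \int[leb]_(p in Q r) (gap p)%:E.
have phi_ge0 r : 0 <= phi r by apply: integral_ge0 => p _; rewrite lee_fin gap_ge0.
have phi_le r : phi r <= M%:E * leb (Q r).
  rewrite -integral_cst//; apply: ge0_le_integral => //.
  - by move=> p _; rewrite lee_fin gap_ge0.
  - exact: measurable_funTS.
  - by move=> p _; rewrite lee_fin.
have phif r : phi r \is a fin_num.
  rewrite ge0_fin_numE//; apply: (le_lt_trans (phi_le r)).
  by rewrite -(fineK (Qfin r)) -EFinM ltry.
have phi_dil (s r : R) : (1 < s)%R ->
    s%:E * phi r <= (s^-1 ^+ n)%:E * phi (s * r)%R + (s - 1)%:E * energy Omega w.
  move=> s1; have s0 : (0 < s)%R by exact: lt_trans s1.
  rewrite /phi -ge0_integral_dilation//; last 2 first.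
  - exact: measurable_funTS.
  - by move=> p _; rewrite lee_fin gap_ge0.
  rewrite (_ : _ @^-1` _ = Q r); last first.
    have sE (p : 'rV[R]_n) i : (`|(s *: p) ord0 i| <= s * r)%R = (`|p ord0 i| <= r)%R.
      by rewrite mxE normrM gtr0_norm// ler_pM2l.
    by apply/seteqP; split => p /= Qp i; [rewrite -sE|rewrite sE]; exact: Qp.
  have mgs : measurable_fun setT (fun p : borel R n => (gap (s *: p)%R)%:E).
    by apply: (measurableT_comp mgap); exact: measurable_dilation.
  apply: (@le_trans _ _ (\int[leb]_(p in Q r)
      ((gap (s *: p)%R)%:E + (s - 1)%:E * `|w (T p)|%:E))).
    rewrite -ge0_integralZl_EFin//; last 3 first.
    - by move=> p _; rewrite lee_fin gap_ge0.
    - exact: measurable_funTS.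
    - exact: ltW.
    apply: ae_ge0_le_integral => //.
    - by move=> p _; rewrite -EFinM lee_fin mulr_ge0 ?gap_ge0// ltW.
    - by apply: measurable_funTS; exact: measurable_funeM.
    - by move=> p _; rewrite -EFinM -EFinD lee_fin addr_ge0 ?gap_ge0// mulr_ge0// subr_ge0 ltW.
    - by apply: measurable_funTS; apply: emeasurable_funD => //; exact: measurable_funeM.
    exists (multiple_contact Omega w); split.
    - exact: measurable_multiple_contact.
    - exact: multiple_contact_null.
    - move=> p /= np; apply: contrapT => Np; apply: np => Qp.
      by rewrite -!EFinM -EFinD lee_fin gap_dilation_le.
  rewrite ge0_integralD//; last 4 first.
  - by move=> p _; rewrite lee_fin gap_ge0.
  - exact: measurable_funTS.
  - by move=> p _; rewrite -EFinM lee_fin mulr_ge0// subr_ge0 ltW.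
  - by apply: measurable_funTS; exact: measurable_funeM.
  apply: leeD => //.
  rewrite energyE -ge0_integralZl_EFin//; last by rewrite subr_ge0 ltW.
  apply: ge0_subset_integral => //; first exact: measurable_funeM.
  by move=> p _; rewrite -EFinM lee_fin mulr_ge0// subr_ge0 ltW.
have E0 : (0 <= fine (energy Omega w))%R by rewrite fine_ge0// energy_ge0.
have phi_bound r : n.+1%:R%:E * phi r <= energy Omega w.
  rewrite -(fineK (phif r)) -(fineK Ef) -EFinM lee_fin.
  apply: (@le_of_le_exprn _ _ _ n) => s s1.
  have s0 : (0 < s)%R by exact: lt_trans s1.
  have := @superhomogeneous_bound _ (fun k => fine (phi (s ^+ k * r)%R)) s
    (M * fine (leb (Q r)))%R (fine (energy Omega w)) n s1 E0.
  rewrite expr0 mul1r; apply => k.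
    rewrite -lee_fin EFinD !EFinM !fineK//.
    by have := phi_dil s (s ^+ k * r)%R s1; rewrite mulrA -exprS.
  rewrite -lee_fin -mulrA !EFinM !fineK//; apply: (le_trans (phi_le _)).
  rewrite QZ ?exprn_gt0// exprAC [X in _ <= _ * X]muleC//.
have cv : phi k%:R @[k --> \oo] --> gap_integral.
  rewrite /gap_integral (_ : setT = \bigcup_k Q k%:R).
    apply: ge0_nondecreasing_set_cvg_integral => //.
    - move=> k l kl; apply/subsetPset => p Qp i; apply: (le_trans (Qp i)).
      by rewrite ler_nat.
    - by move=> k; exact: measurable_funTS.
    - by move=> k p _; rewrite lee_fin gap_ge0.
  apply/seteqP; split => // p _.
  have [r r0 pr] := compact_coord_bounded (@compact_set1 _ p).
  exists (Num.bound r) => // i; apply: (le_trans (pr p erefl i)).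
  by apply/ltW/archi_boundP/ltW.
have cv2 : n.+1%:R%:E * phi k%:R @[k --> \oo] --> n.+1%:R%:E * gap_integral by exact: cvgeZl.
rewrite -(cvg_lim (@ereal_hausdorff R) cv2); apply: lime_le.
  by apply/cvg_ex; eexists; exact: cv2.
by near=> k; exact: phi_bound.
Unshelve. all: by end_near. Qed.

End energy_formula.

(** * Convex functions with zero boundary values *)

Section convex.
Context {R : realType} {n : nat}.
Implicit Types (Omega : set 'rV[R]_n) (p x y z d : 'rV[R]_n) (s t : R).
Implicit Types (u v w b c f g : 'rV[R]_n -> R).

Lemma convex_onP Omega f : convex_on Omega f <->
  (forall x y t, Omega x -> Omega y -> 0 <= t <= 1 ->
    f (t *: x + (1 - t) *: y) <= t * f x + (1 - t) * f y).
Proof.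
split => [cf x y t Ox Oy /andP[t0 t1]|cf t x y].
  by have := cf (Itv01 t0 t1) x y; rewrite !inE => /(_ Ox Oy).
rewrite !inE => Ox Oy; apply: cf => //.
by apply/andP; split; [exact: ge0|exact: le1].
Qed.

Lemma convex_set_comb Omega x y t : @convex_set R 'rV[R]_n Omega ->
  Omega x -> Omega y -> 0 <= t <= 1 -> Omega (t *: x + (1 - t) *: y).
Proof.
move=> cO Ox Oy /andP[t0 t1].
by have := cO x y (Itv01 t0 t1) (mem_set Ox) (mem_set Oy); rewrite inE.
Qed.

Lemma eq_convex_on Omega f g : @convex_set R 'rV[R]_n Omega ->
  (forall x, Omega x -> f x = g x) -> convex_on Omega f -> convex_on Omega g.
Proof.
move=> cO fg /convex_onP cf; apply/convex_onP => x y t Ox Oy t01.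
by rewrite -!fg//; [exact: cf|exact: convex_set_comb].
Qed.

Lemma open_segment Omega x d : open Omega -> Omega x ->
  exists2 t, 0 < t & forall s, `|s| <= t -> Omega (x + s *: d).
Proof.
move=> oO Ox.
have cl : (fun s : R => x + s *: d) @ (0 : R) --> x + 0 *: d.
  apply: cvgD; first exact: cvg_cst.
  by apply: cvgZ; [exact: cvg_id|exact: cvg_cst].
have : nbhs (x + 0 *: d) Omega by rewrite scale0r addr0; exact: open_nbhs_nbhs.
move=> /cl/nbhs_ballP[e /= e0 eO].
exists (e / 2); first by rewrite divr_gt0.
move=> s se; apply: eO; rewrite /ball/= sub0r normrN (le_lt_trans se)//.
by rewrite ltr_pdivrMr// mulr_natr mulr2n ltrDl.
Qed.

(** Convexity bounds f from above near x along segments that start at x; the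
    lower bound at y is the upper bound at the reflection of y in x. *)
Lemma convex_bounded_continuous Omega f (M : R) : open Omega ->
    convex_on Omega f -> (forall x, Omega x -> `|f x| <= M) ->
  forall x, Omega x -> f @ x --> f x.
Proof.
move=> oO /convex_onP cf fM x Ox; apply/(@cvgrPdist_lt _ _ _ (nbhs x) (nbhs_filter x)) => e e0.
have /nbhs_ballP[r /= r0 xr] : nbhs x Omega by exact: open_nbhs_nbhs.
have M0 : 0 <= M by apply: le_trans (fM _ Ox).
(* any t in ]0, 1] with 2 M t < e would do *)
pose t := e / (e + 2 * M + 1).
have den : 0 < e + 2 * M + 1 by lra.
have t0 : 0 < t by rewrite divr_gt0.
have t1 : t <= 1 by rewrite ler_pdivrMr// mul1r; lra.
have tM : 2 * M * t < e.
  by rewrite /t mulrA ltr_pdivrMr//; nra.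
have upper y : `|x - y| < t * r -> Omega y /\ f y - f x < e.
  move=> xy; pose z := x + t^-1 *: (y - x).
  have Oz : Omega z.
    apply: xr; rewrite -ball_normE/= /z opprD addrA subrr add0r normrN normrZ.
    by rewrite gtr0_norm ?invr_gt0// ltr_pdivrMl// distrC.
  have yE : y = t *: z + (1 - t) *: x.
    rewrite /z scalerDr scalerA mulfV ?gt_eqF// scale1r scalerBl scale1r.
    by rewrite [t *: x + _]addrC -addrA [x - t *: x]addrC addNKr subrK.
  split.
    apply: xr; rewrite -ball_normE/=; apply: (lt_le_trans xy).
    by rewrite -[leRHS]mul1r ler_wpM2r// ltW.
  rewrite {1}yE; apply: (@le_lt_trans _ _ (2 * M * t)) => //.
  have := cf z x t Oz Ox; rewrite (ltW t0) t1 => /(_ isT).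
  have := fM _ Oz; have := fM _ Ox; rewrite !ler_norml => /andP[? ?] /andP[? ?].
  have : t * f z <= t * M by rewrite ler_wpM2l// ltW.
  have : t * - M <= t * f x by rewrite ler_wpM2l// ltW.
  lra.
apply/nbhs_ballP; exists (t * r) => /=; first by rewrite mulr_gt0.
move=> y; rewrite -ball_normE/= => xy.
have [Oy fyx] := upper y xy.
pose z := x + (x - y).
have [Oz fzx] : Omega z /\ f z - f x < e.
  by apply: upper; rewrite /z opprD addrA subrr add0r normrN.
have xE : x = 2^-1 *: y + (1 - 2^-1) *: z.
  have -> : 1 - 2^-1 = 2^-1 :> R by lra.
  rewrite -scalerDr /z addrCA [y + _]addrC subrK -[x + x]mulr2n -[x *+ 2]scaler_nat scalerA.
  by rewrite mulVf ?scale1r// pnatr_eq0.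
have := cf y z 2^-1 Oy Oz; rewrite -xE => h.
have {}h : f x <= 2^-1 * f y + (1 - 2^-1) * f z by apply: h; lra.
by rewrite ltr_norml; apply/andP; split; lra.
Qed.

Section zero_boundary.
Variables (Omega : set 'rV[R]_n).
Hypotheses (oO : open Omega) (kO : compact (closure Omega)).
Local Notation S := (closure Omega).

Lemma continuous_extension u : {within S, continuous u} ->
  (forall x, frontier Omega x -> u x = 0) -> continuous (u \_ Omega).
Proof.
move=> /subspace_continuousP cu ufr x.
have patch0 y : ~ Omega y -> (u \_ Omega) y = 0.
  by rewrite patchE; case: ifPn => //; rewrite inE.
have patchS y : S y -> (u \_ Omega) y = u y.
  move=> Sy; have [Oy|nOy] := pselect (Omega y); first by rewrite patchE mem_set.
  rewrite patch0// ufr//; split => //; apply: contra_not nOy.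
  exact: interior_subset.
apply/(@cvgrPdist_lt _ _ _ (nbhs x) (nbhs_filter x)) => e e0.
have [Sx|nSx] := pselect (S x); last first.
  have nS : nbhs x (~` S).
    by apply: open_nbhs_nbhs; split => //; apply: closed_openC; exact: closed_closure.
  near=> y; have nSy : (~` S) y by near: y.
  rewrite !patch0 ?subrr ?normr0// => Oy.
    by apply: nSy; exact: subset_closure.
  by apply: nSx; exact: subset_closure.
have ux : \forall y \near x, S y -> `|u x - u y| < e.
  by have /cvgrPdist_lt/(_ e e0) := cu x Sx.
have [Ox|nOx] := pselect (Omega x).
  have xO : \forall y \near x, Omega y by exact: open_nbhs_nbhs.
  near=> y.
  have Oy : Omega y by near: y.
  rewrite !patchS//; last exact: subset_closure.
  have : S y -> `|u x - u y| < e by near: y.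
  by apply; exact: subset_closure.
near=> y; have [Oy|nOy] := pselect (Omega y); last by rewrite !patch0// subrr normr0.
have Sy : S y by exact: subset_closure.
rewrite !patchS//.
have : S y -> `|u x - u y| < e by near: y.
by apply.
Unshelve. all: by end_near. Qed.

Variable u : 'rV[R]_n -> R.
Hypotheses (cu : continuous u) (u_cvx : convex_on Omega u)
  (u_out : forall x, ~ Omega x -> u x = 0).

(** A positive maximum would be attained at an interior point, and by
    convexity on a whole ball around it.  The maximum set would then be compact
    without a point where the first coordinate is maximal. *)
Lemma convex_le0 : (0 < n)%N -> forall x, u x <= 0.
Proof.
move=> n0 x0; rewrite leNgt; apply/negP => ux0.
have Ox0 : Omega x0 by apply: contrapT => /u_out u0; rewrite u0 ltxx in ux0.
have S0 : S !=set0 by exists x0; exact: subset_closure.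
have cNu : continuous (fun x => - u x).
  by move=> x; apply: (@cvgN _ _ _ (nbhs x) (nbhs_filter x)); exact: cu.
have [x1 Sx1 ux1] := @legendre_max R n S (fun x => - u x) 0 S0 kO cNu.
have {}ux1 z : u z <= u x1.
  have d0 y : dotp (0 : 'rV[R]_n) y = 0 by rewrite /dotp big1// => i _; rewrite mxE mul0r.
  have [Oz|/u_out ->] := pselect (Omega z).
    by have := ux1 z (subset_closure Oz); rewrite !d0 !opprK !add0r.
  by have := ux1 _ (subset_closure Ox0); rewrite !d0 !opprK !add0r; lra.
pose K := S `&` [set x | u x1 <= u x].
have kK : compact K.
  apply: (subclosed_compact _ kO); last by move=> x [].
  apply: closedI; first exact: closed_closure.
  by apply: (@closed_comp _ _ u [set s | u x1 <= s]) => [x _|]; [exact: cu|exact: closed_ge].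
pose i0 := Ordinal n0.
have [|y [Sy uy] yM] := @legendre_max R n K (fun=> 0) (delta_mx ord0 i0) _ kK (@cst_continuous _ _ 0).
  by exists x1; split => //=.
have Oy : Omega y.
  apply: contrapT => /u_out uy0; move: uy; rewrite /= uy0 leNgt (lt_le_trans ux0)//.
have [t t0 tO] := open_segment (delta_mx ord0 i0) oO Oy.
have Op : Omega (y + t *: delta_mx ord0 i0) by apply: tO; rewrite gtr0_norm.
have Om : Omega (y - t *: delta_mx ord0 i0) by rewrite -scaleNr; apply: tO; rewrite normrN gtr0_norm.
have yE : y = 2^-1 *: (y + t *: delta_mx ord0 i0) + (1 - 2^-1) *: (y - t *: delta_mx ord0 i0).
  have -> : 1 - 2^-1 = 2^-1 :> R by lra.
  rewrite -scalerDr addrACA subrr addr0 -[y + y]mulr2n -[y *+ 2]scaler_nat scalerA.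
  by rewrite mulVf ?scale1r// pnatr_eq0.
have /convex_onP cvx := u_cvx.
have := cvx _ _ 2^-1 Op Om; rewrite -yE => h.
have {}h : u y <= 2^-1 * u (y + t *: delta_mx ord0 i0) +
                  (1 - 2^-1) * u (y - t *: delta_mx ord0 i0) by apply: h; lra.
have Kp : K (y + t *: delta_mx ord0 i0).
  split; first exact: subset_closure.
  by have := ux1 (y - t *: delta_mx ord0 i0); move: uy => /=; lra.
have := yM _ Kp; rewrite !dotp_delta !mxE !eqxx/=; lra.
Qed.

(** A zero inside Omega can be written as a convex combination of a point where
    u < 0 and a point beyond it where u <= 0. *)
Lemma convex_lt0 : (0 < n)%N -> (exists x, u x != 0) ->
  forall x, Omega x -> u x < 0.
Proof.
move=> n0 [x0 ux0] x Ox; rewrite lt_neqAle convex_le0// andbT.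
apply/eqP => ux.
have Ox0 : Omega x0 by apply: contrapT => /u_out /eqP; rewrite (negbTE ux0).
have {}ux0 : u x0 < 0 by rewrite lt_neqAle ux0 convex_le0.
have [t t0 tO] := open_segment (x - x0) oO Ox.
have Oz : Omega (x + t *: (x - x0)) by apply: tO; rewrite gtr0_norm.
have /convex_onP cvx := u_cvx.
have t10 : 0 < 1 + t by lra.
have := cvx _ _ (1 + t)^-1 Oz Ox0.
have -> : (1 + t)^-1 *: (x + t *: (x - x0)) + (1 - (1 + t)^-1) *: x0 = x.
  rewrite (_ : 1 - (1 + t)^-1 = (1 + t)^-1 * t); last by field; lra.
  rewrite -scalerA -scalerDr scalerBr addrA addrNK -{1}[x]scale1r -scalerDl.
  by rewrite scalerA mulVf ?scale1r// gt_eqF.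
rewrite ux => h.
have {}h : 0 <= (1 + t)^-1 * u (x + t *: (x - x0)) + (1 - (1 + t)^-1) * u x0.
  by apply: h; rewrite invr_ge0 ltW//= invf_le1//; lra.
have : (1 + t)^-1 * u (x + t *: (x - x0)) <= 0 by rewrite pmulr_rle0 ?invr_gt0// convex_le0.
have : (1 - (1 + t)^-1) * u x0 < 0.
  by rewrite pmulr_rlt0// subr_gt0 invf_lt1//; lra.
lra.
Qed.

End zero_boundary.

End convex.

(** * The largest convex function below a given function *)

Section envelope.
Context {R : realType} {n : nat}.
Variables (Omega : set 'rV[R]_n) (v b : 'rV[R]_n -> R).
Implicit Types (p x y z d : 'rV[R]_n) (s t : R) (c : 'rV[R]_n -> R).
Hypotheses (Omega0 : Omega !=set0) (oO : open Omega) (kO : compact (closure Omega))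
  (cvxO : @convex_set R 'rV[R]_n Omega).
Hypotheses (cb : continuous b) (b_cvx : convex_on Omega b)
  (b_out : forall x, ~ Omega x -> b x = 0) (b_le : forall x, b x <= v x)
  (v_le0 : forall x, v x <= 0).
Local Notation S := (closure Omega).

Definition convex_minorant c := convex_on Omega c /\ forall y, Omega y -> c y <= v y.

(** A supremum over all convex minorants, not only affine ones: then the
    convex function b below v is itself a minorant, and b <= envelope follows
    without a separation theorem. *)
Definition envelope x : R :=
  if pselect (Omega x) then sup [set c x | c in convex_minorant] else 0.

Let v_out x : ~ Omega x -> v x = 0.
Proof. by move=> /b_out bx; apply/eqP; rewrite eq_le v_le0 -bx b_le. Qed.

Let S0 : S !=set0.
Proof. by have [x Ox] := Omega0; exists x; exact: subset_closure. Qed.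

Let b_minorant : convex_minorant b.
Proof. by split. Qed.

Lemma envelope_ge c x : convex_minorant c -> Omega x -> c x <= envelope x.
Proof.
move=> mc Ox; rewrite /envelope; case: pselect => //= Ox1.
apply: ub_le_sup; last by exists c.
by exists (v x) => _ [c' [_ c'v] <-]; exact: c'v.
Qed.

Lemma envelope_sup_le x (M : R) : Omega x ->
  (forall c, convex_minorant c -> c x <= M) -> envelope x <= M.
Proof.
move=> Ox h; rewrite /envelope; case: pselect => //= Ox1.
apply: ge_sup => [|_ [c mc <-]]; last exact: h.
by exists (b x), b.
Qed.

Lemma envelope_out x : ~ Omega x -> envelope x = 0.
Proof. by rewrite /envelope; case: pselect. Qed.

Lemma envelope_le x : envelope x <= v x.
Proof.
have [Ox|nOx] := pselect (Omega x); last by rewrite envelope_out ?v_out.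
by apply: envelope_sup_le => // c [_ cv]; exact: cv.
Qed.

Lemma le_envelope x : b x <= envelope x.
Proof.
have [Ox|nOx] := pselect (Omega x); last by rewrite envelope_out ?b_out.
exact: envelope_ge.
Qed.

Lemma envelope_le0 x : envelope x <= 0.
Proof. exact: le_trans (envelope_le x) (v_le0 x). Qed.

Lemma envelope_convex : convex_on Omega envelope.
Proof.
apply/convex_onP => x y t Ox Oy t01; apply: envelope_sup_le => [|c mc].
  exact: convex_set_comb.
have [/convex_onP cc _] := mc; apply: (le_trans (cc x y t Ox Oy t01)).
move: t01 => /andP[t0 t1].
by rewrite lerD// ler_wpM2l ?subr_ge0// envelope_ge.
Qed.

(** Inside Omega a bounded convex function is continuous; elsewhere the
    envelope is squeezed between b and 0, which agree there. *)
Lemma envelope_continuous : continuous envelope.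
Proof.
have [M bM] := continuous_lower_bound kO cb.
move=> x; have [Ox|nOx] := pselect (Omega x).
  apply: (@convex_bounded_continuous _ _ Omega _ `|M| oO envelope_convex) => // y Oy.
  rewrite ler0_norm ?envelope_le0// lerNl.
  apply: le_trans (le_envelope y); apply: le_trans (bM _ (subset_closure Oy)).
  by rewrite lerN2 ler_norm.
apply/(@cvgrPdist_lt _ _ _ (nbhs x) (nbhs_filter x)) => e e0.
have cbx : b @ x --> b x by exact: cb.
move: cbx => /(@cvgrPdist_lt _ _ _ (nbhs x) (nbhs_filter x))/(_ e e0).
rewrite b_out// envelope_out// => h.
near=> y; rewrite sub0r normrN ler0_norm ?envelope_le0//.
have : `|0 - b y| < e by near: y.
rewrite sub0r normrN ltr_norml => /andP[eb _].
by have := le_envelope y; lra.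
Unshelve. all: by end_near. Qed.

Lemma affine_convex p (a : R) : convex_on Omega (fun y => dotp p y - a).
Proof. by apply/convex_onP => x y t _ _ _; rewrite dotpDr !dotpZr; lra. Qed.

(** Affine functions below v are convex minorants of v. *)
Lemma legendre_envelope p : legendre S envelope p = legendre S v p.
Proof.
have [r r0 Sr] := compact_coord_bounded kO.
have [M bM] := continuous_lower_bound kO cb.
have vM y : S y -> - M <= v y by move=> /bM h; exact: le_trans (b_le y).
have eM y : S y -> - M <= envelope y by move=> /bM h; exact: le_trans (le_envelope y).
apply/eqP; rewrite eq_le; apply/andP; split; apply: legendre_le => // y Sy.
  have [Oy|nOy] := pselect (Omega y); last first.
    by rewrite envelope_out// -(v_out nOy); exact: (legendre_ub Sr vM).
  rewrite lerBlDr -lerBlDl.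
  apply: (@envelope_ge (fun y => dotp p y - legendre S v p)) => //.
  split; first exact: affine_convex.
  move=> z Oz; have := legendre_ub Sr vM p (subset_closure Oz); lra.
apply: le_trans (legendre_ub Sr eM p Sy).
by rewrite lerD2l lerN2 envelope_le.
Qed.

End envelope.

(** * Energy, mass and the eigenvalue *)

Section eigenvalue.
Context {R : realType} {n : nat}.
Variables (Omega : set 'rV[R]_n).
Implicit Types (p x y z : 'rV[R]_n) (u w : 'rV[R]_n -> R).
Hypotheses (oO : open Omega) (kO : compact (closure Omega)).
Local Notation S := (closure Omega).
Local Notation leb := (lebesgue : set (borel R n) -> \bar R).
Local Open Scope ereal_scope.

Let mO : measurable (Omega : set (borel R n)).
Proof. exact: open_borel. Qed.

Lemma lebesgue_domain_fin : leb Omega \is a fin_num.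
Proof.
have [r r0 Sr] := compact_coord_bounded kO.
rewrite ge0_fin_numE ?lebesgue_ge0//; apply: (@lebesgue_bounded_lty _ _ _ r) => x Ox.
by apply: Sr; exact: subset_closure.
Qed.

Lemma measurable_norm_exp w k : continuous w ->
  measurable_fun setT (fun x : borel R n => (`|w x| ^+ k)%:E).
Proof.
move=> cw; apply/measurable_EFinP; apply: measurable_funX.
by apply: measurableT_comp => //; exact: continuous_borel_fun.
Qed.

Lemma mass_ge0 w : 0 <= mass Omega w.
Proof. by apply: integral_ge0 => x _; rewrite lee_fin exprn_ge0. Qed.

Lemma integral_norm_exp_lty w k (E : set (borel R n)) : continuous w ->
  measurable E -> E `<=` Omega ->
  \int[leb]_(x in E) (`|w x| ^+ k)%:E < +oo.
Proof.
move=> cw mE EO.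
have cnw : continuous (fun x => - `|w x|)%R.
  move=> x; apply: (@cvgN _ _ _ (nbhs x) (nbhs_filter x)).
  by apply: (@cvg_norm _ _ _ (nbhs x) (nbhs_filter x)); exact: cw.
have [M wM] := continuous_lower_bound kO cnw.
apply: (@le_lt_trans _ _ (\int[leb]_(x in E) (`|M| ^+ k)%:E)).
  apply: ge0_le_integral => //.
    by apply: measurable_funTS; exact: measurable_norm_exp.
  move=> x /EO Ox; rewrite lee_fin lerXn2r ?nnegrE//.
  by have := wM x (subset_closure Ox); rewrite lerN2 => h; exact: le_trans (ler_norm M).
rewrite integral_cst//.
apply: (@le_lt_trans _ _ ((`|M| ^+ k)%:E * leb Omega)).
  by apply: lee_wpmul2l; [rewrite lee_fin exprn_ge0|exact: le_lebesgue].
by rewrite -(fineK lebesgue_domain_fin) -EFinM ltry.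
Qed.

Lemma mass_fin w : continuous w -> mass Omega w \is a fin_num.
Proof.
by move=> cw; rewrite ge0_fin_numE ?mass_ge0//; exact: integral_norm_exp_lty.
Qed.

Section eq_on_domain.
Variables w w' : 'rV[R]_n -> R.
Hypothesis ww' : forall x, Omega x -> w x = w' x.

Lemma eq_monge_ampere : monge_ampere Omega w = monge_ampere Omega w'.
Proof.
have e x : Omega x -> subdifferential Omega w x = subdifferential Omega w' x.
  by move=> Ox; apply/seteqP; split => p px y Oy; have := px y Oy; rewrite !ww'.
apply/funext => E; rewrite /monge_ampere; congr lebesgue.
by apply: eq_bigcupr => x [_ Ox]; exact: e.
Qed.

Lemma eq_energy : energy Omega w = energy Omega w'.
Proof.
rewrite /energy eq_monge_ampere /integral.
have -> // : (fun x => `|w x|%:E) \_ Omega = (fun x => `|w' x|%:E) \_ Omega.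
by apply/funext => x; rewrite !patchE; case: ifPn => // /set_mem/ww' ->.
Qed.

Lemma eq_mass : mass Omega w = mass Omega w'.
Proof. by apply: eq_integral => x; rewrite inE => Ox; rewrite ww'. Qed.

End eq_on_domain.

Hypothesis Omega0 : Omega !=set0.

(** The energy integrates against a set function, which is known to be a measure
    only through [monge_ampere_pushforward]; hence the continuity hypothesis. *)
Lemma energy_nonneg w : {within S, continuous w} ->
  (forall x, frontier Omega x -> w x = 0%R) -> 0 <= energy Omega w.
Proof.
move=> cw wf.
have eqw x : Omega x -> w x = (w \_ Omega) x by move=> Ox; rewrite patchE mem_set.
have w_out x : ~ Omega x -> (w \_ Omega) x = 0%R.
  by move=> nOx; rewrite patchE memNset.
have cw' := continuous_extension oO cw wf.
by rewrite (eq_energy eqw); apply: energy_ge0.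
Qed.

Lemma eigenvalue_ge0 : 0 <= MA_eigenvalue Omega.
Proof.
apply: le_ereal_inf_tmp => _ [w [cw _ _ wf] <-].
by rewrite /rayleigh mule_ge0 ?energy_nonneg// inve_ge0 mass_ge0.
Qed.

Lemma eigenvalue_mass_le w : continuous w -> admissible Omega w ->
  MA_eigenvalue Omega * mass Omega w <= energy Omega w.
Proof.
move=> cw aw; have [_ _ _ wf] := aw.
have E0 : 0 <= energy Omega w by apply: energy_nonneg => //; exact: continuous_subspaceT.
have [->|m0] := eqVneq (mass Omega w) 0; first by rewrite mule0.
have : MA_eigenvalue Omega <= rayleigh Omega w by apply: ereal_inf_lbound; exists w.
rewrite /rayleigh -(fineK (mass_fin cw)) inver.
have mp : (0 < fine (mass Omega w))%R.
  by rewrite fine_gt0// lt_neqAle eq_sym m0 mass_ge0/= ltey_eq (mass_fin cw).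
by rewrite gt_eqF// lee_pdivlMr.
Qed.

End eigenvalue.

(** * Pushing a function down on a compact set *)

Section variation.
Context {R : realType} {n : nat}.
Variables (Omega : set 'rV[R]_n) (u : 'rV[R]_n -> R).
Implicit Types (p x y z : 'rV[R]_n) (K : set 'rV[R]_n) (j t m : R).
Hypotheses (Omega0 : Omega !=set0) (oO : open Omega)
  (kO : compact (closure Omega)) (cvxO : @convex_set R 'rV[R]_n Omega).
Hypotheses (cu : continuous u) (u_cvx : convex_on Omega u)
  (u_out : forall x, ~ Omega x -> u x = 0)
  (u_lt0 : forall x, Omega x -> u x < 0).
Local Notation S := (closure Omega).
Local Notation leb := (lebesgue : set (borel R n) -> \bar R).
Local Notation lambda := (MA_eigenvalue Omega).

Let u_le0 x : u x <= 0.
Proof. by have [/u_lt0/ltW|/u_out ->] := pselect (Omega x). Qed.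

Let S0 : S !=set0.
Proof. by have [x Ox] := Omega0; exists x; exact: subset_closure. Qed.

(** The cases j = 1 and j = 0 push down u and the zero function; the second
    one serves to exclude an infinite eigenvalue. *)
Definition pushed j K t x : R := j * u x - t * (x \in K)%:R.

(** The slopes at which pushing j u down by t on K raises the Legendre
    transform. *)
Definition raised j K t : set 'rV[R]_n :=
  [set p | legendre S (fun x => j * u x) p < legendre K (fun x => j * u x) p + t].

Let cju j : continuous (fun x => j * u x).
Proof.
move=> x; apply: (@cvgM _ _ (nbhs x) (nbhs_filter x)); last exact: cu.
exact: cvg_cst.
Qed.

Lemma raised_mono j K s t : s <= t -> raised j K s `<=` raised j K t.
Proof. by move=> st p; rewrite /raised/= => h; rewrite (lt_le_trans h)// lerD2l. Qed.

Section compact_push.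
Variable K : set 'rV[R]_n.
Hypotheses (kK : compact K) (K0 : K !=set0) (KO : K `<=` Omega).

Let KS : K `<=` S.
Proof. by move=> x /KO; exact: subset_closure. Qed.

Lemma compact_lt0 : exists2 m, 0 < m & forall x, K x -> u x <= - m.
Proof.
have cNu : continuous (fun x => - u x).
  by move=> x; apply: (@cvgN _ _ _ (nbhs x) (nbhs_filter x)); exact: cu.
have [y Ky My] := @legendre_max R n K (fun x => - u x) 0 K0 kK cNu.
exists (- u y); first by rewrite oppr_gt0 u_lt0//; exact: KO.
have d0 z : dotp (0 : 'rV[R]_n) z = 0 by rewrite /dotp big1// => i _; rewrite mxE mul0r.
by move=> x /My; rewrite !d0 !opprK !add0r.
Qed.

Lemma room : exists2 r, 0 < r & forall y i, K y ->
  Omega (y + r *: delta_mx ord0 i) /\ Omega (y - r *: delta_mx ord0 i).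
Proof.
have /compact_near_coveringP cK := kK.
have [r [r0 rK]] : exists r : R, 0 < r /\ forall y, K y -> forall z,
    (forall i k, `|y i k - z i k| <= r) -> Omega z.
  have h : \forall r \near (0 : R)^'+, K `<=` [set y | forall z : 'rV[R]_n,
      (forall i k, `|y i k - z i k| <= r) -> Omega z].
    apply: (cK R ((0 : R)^'+) (fun r y => forall z : 'rV[R]_n,
      (forall i k, `|y i k - z i k| <= r) -> Omega z)) => y /KO Oy.
    have /nbhs_ballP[e /= e0 ye] : nbhs y Omega by exact: open_nbhs_nbhs.
    exists (ball y (e / 2), [set r | r < e / 2]) => /=.
      split; first by apply: nbhsx_ballx; rewrite divr_gt0.
      by apply: nbhs_right_lt; rewrite divr_gt0.
    move=> [y' r] /= [[_ yy'] re] z zr; apply: ye; split => // i k.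
    have := yy' i k; rewrite /ball/= => h.
    have := zr i k => h2.
    rewrite (_ : y i k - z i k = (y i k - y' i k) + (y' i k - z i k)); last by rewrite addrA addrNK.
    by apply: (le_lt_trans (ler_normD _ _)); lra.
  near (0 : R)^'+ => r; exists r; split.
    by near: r; exact: nbhs_right_gt.
  by move=> y Ky z zr; apply: (near h r _ y Ky z zr).
have small (i k : 'I_1) (l i0 : 'I_n) : `|(r *: delta_mx ord0 i0 : 'rV[R]_n) i l| <= r.
  rewrite !mxE normrM gtr0_norm//; case: (_ && _); rewrite ?normr0 ?normr1 ?mulr0 ?mulr1//.
  exact: ltW.
exists r => // y i0 Ky; split; apply: (rK y Ky) => i l.
  have -> : y i l - (y + r *: delta_mx ord0 i0) i l = - (r *: delta_mx ord0 i0 : 'rV[R]_n) i l.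
    by rewrite [(y + _) i l]mxE opprD addrA subrr add0r.
  by rewrite normrN small.
have -> : y i l - (y - r *: delta_mx ord0 i0) i l = (r *: delta_mx ord0 i0 : 'rV[R]_n) i l.
  by rewrite mxE [X in _ - (_ + X)]mxE opprD addrA subrr add0r opprK.
exact: small.
Unshelve. all: by end_near. Qed.

(** A point y of K can be moved by r along every axis inside Omega.  A slope p
    with |p i| large therefore gains r |p i| by moving away from K, more than
    the push can compensate. *)
Lemma raised_bounded j t : 0 <= j -> exists r, coord_bounded (raised j K t) r.
Proof.
move=> j0; have [r r0 rK] := room.
have [q q0 Sq] := compact_coord_bounded kO.
have [M SM] := continuous_lower_bound kO (cju (j := j)).
have KM y : K y -> - M <= j * u y by move=> /KS /SM.
have Kq : coord_bounded K q by move=> y /KS /Sq.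
exists ((t + M) / r) => p pA i.
have [y Ky My] : exists2 y, K y &
    legendre S (fun x => j * u x) p < dotp p y - j * u y + t.
  have [y Ky My] := legendre_max p K0 kK (cju (j := j)); exists y => //.
  by apply: (lt_le_trans pA); rewrite lerD2r; exact: legendre_le.
have [Op Om] := rK y i Ky.
have := legendre_ub Sq SM p (subset_closure Op).
have := legendre_ub Sq SM p (subset_closure Om).
have e s : dotp p (s *: delta_mx ord0 i) = s * p ord0 i by rewrite dotpZr dotpC dotp_delta.
rewrite !dotpDr dotpNr !e => h1 h2.
have up := mulr_ge0_le0 j0 (u_le0 (y + r *: delta_mx ord0 i)).
have um := mulr_ge0_le0 j0 (u_le0 (y - r *: delta_mx ord0 i)).
have yM := KM y Ky.
rewrite ler_pdivlMr//; case: (ler0P (p ord0 i)) => _; lra.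
Qed.

Lemma raised_lty j t : 0 <= j -> (leb (raised j K t) < +oo)%E.
Proof.
by move=> /raised_bounded -/(_ t)[r rA]; exact: (@lebesgue_bounded_lty _ _ _ r).
Qed.

Lemma open_raised j t : open (raised j K t).
Proof.
have [q q0 Sq] := compact_coord_bounded kO.
have [M SM] := continuous_lower_bound kO (cju (j := j)).
have Kq : coord_bounded K q by move=> y /KS /Sq.
have KM y : K y -> - M <= j * u y by move=> /KS /SM.
rewrite (_ : raised j K t = (fun p => legendre S (fun x => j * u x) p -
    legendre K (fun x => j * u x) p) @^-1` [set s | s < t]).
  apply: open_comp; last exact: open_lt.
  move=> p _; apply: (@cvgB _ _ _ (nbhs p) (nbhs_filter p)).
    exact: (continuous_legendre S0 Sq SM).
  exact: (continuous_legendre K0 Kq KM).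
by apply/seteqP; split => p; rewrite /raised/= ltrBlDl.
Qed.

Lemma measurable_raised j t : measurable (raised j K t : set (borel R n)).
Proof. by apply: open_borel; exact: open_raised. Qed.

Lemma measurable_pushed j t : measurable_fun setT (pushed j K t : borel R n -> R).
Proof.
have mK : measurable (K : set (borel R n)).
  by apply: closed_borel; apply: compact_closed => //; exact: norm_hausdorff.
rewrite (_ : pushed j K t = (fun x => j * u x) \- (fun x => t * \1_K x)); last first.
  by apply/funext => x; rewrite /pushed /= indicE.
apply: measurable_funB; first by apply: continuous_borel_fun; exact: cju.
by apply: measurable_funM => //; exact: measurable_indic.
Qed.

Section competitor.
Variables j t : R.
Hypotheses (j0 : 0 <= j) (t0 : 0 < t).

Let v := pushed j K t.
Let w := envelope Omega v.

Let lower : exists2 k, 0 <= k & forall x, k * u x <= v x.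
Proof.
(* u <= - m on K, so that (t / m) u <= - t there *)
have [m m0 Km] := compact_lt0; exists (j + t / m).
  by rewrite addr_ge0// divr_ge0// ltW.
move=> x; rewrite /v /pushed mulrDl lerD2l.
have [xK|xK] := boolP (x \in K); last first.
  by rewrite mulr0 oppr0 mulr_ge0_le0// divr_ge0// ltW.
rewrite mulr1; have := Km x (set_mem xK) => h.
have : t / m * u x <= t / m * - m by rewrite ler_wpM2l// divr_ge0// ltW.
by rewrite mulrN divfK// gt_eqF.
Qed.

Let v_le0 x : v x <= 0.
Proof.
by rewrite /v /pushed subr_le0 (@le_trans _ _ 0)// ?mulr_ge0_le0// mulr_ge0// ltW.
Qed.

(* the part of b in the section on envelopes is played by k u *)
Let env_facts : [/\ continuous w, convex_on Omega w, (forall x, w x <= v x) &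
  forall p, legendre S w p = legendre S v p].
Proof.
have [k k0 kv] := lower.
have kc : convex_on Omega (fun x => k * u x).
  apply/convex_onP => x y s Ox Oy s01; have /convex_onP cc := u_cvx.
  by have := ler_wpM2l k0 (cc x y s Ox Oy s01); lra.
have ko x : ~ Omega x -> k * u x = 0 by move=> /u_out ->; rewrite mulr0.
split.
- exact: (envelope_continuous oO kO cvxO (cju (j := k)) kc ko kv v_le0).
- exact: (envelope_convex cvxO kc kv).
- exact: (envelope_le kc ko kv v_le0).
- exact: (legendre_envelope Omega0 kO (cju (j := k)) kc ko kv v_le0).
Qed.

Let w_out x : ~ Omega x -> w x = 0.
Proof. exact: envelope_out. Qed.

Let w_admissible : admissible Omega w.
Proof.
have [cw wc wv _] := env_facts; split => //.
- exact: continuous_subspaceT.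
- have [x Kx] := K0; exists x; first exact: KO.
  rewrite lt_eqF// (le_lt_trans (wv x))// /v /pushed mem_set// mulr1.
  by rewrite subr_lt0 (le_lt_trans _ t0)// mulr_ge0_le0.
- by move=> x [_ nx]; apply: w_out => Ox; apply: nx; rewrite (iffLR (interior_id _) oO).
Qed.

Let legendre_pushed_le (p : 'rV[R]_n) : legendre S v p <=
  legendre S (fun x => j * u x) p + t * (p \in raised j K t)%:R.
Proof.
have [q q0 Sq] := compact_coord_bounded kO.
have [M SM] := continuous_lower_bound kO (cju (j := j)).
have Kq : coord_bounded K q by move=> y /KS /Sq.
have KM y : K y -> - M <= j * u y by move=> /KS /SM.
apply: legendre_le => // y Sy; rewrite /v /pushed.
have yS := legendre_ub Sq SM p Sy.
have t_gt0 := t0.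
have [yK|yK] := boolP (y \in K); have [pA|pA] := boolP (p \in raised j K t);
  rewrite /= ?mulr1 ?mulr0 ?addr0; try lra.
have := legendre_ub Kq KM p (set_mem yK).
have : ~ (raised j K t) p by move/mem_set; exact/negP.
rewrite /raised/= => /negP; rewrite -leNgt; lra.
Qed.

(** The convex envelope w of the pushed function is admissible, and its
    Legendre transform is that of the pushed function, so that its gap exceeds
    that of j u by at most t on the raised slopes and nowhere else. *)
Lemma competitor_bound : (lambda * \int[leb]_(x in Omega) (`|v x| ^+ n.+1)%:E <=
  n.+1%:R%:E * (gap_integral Omega (fun x => j * u x)%R + t%:E * leb (raised j K t)))%E.
Proof.
have [cw wc wv wL] := env_facts.
have w_le0 x : w x <= 0 by exact: le_trans (wv x) (v_le0 x).
have ju_le0 x : j * u x <= 0 by exact: mulr_ge0_le0.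
have ju_out x : ~ Omega x -> j * u x = 0 by move=> /u_out ->; rewrite mulr0.
have mO : measurable (Omega : set (borel R n)) by exact: open_borel.
have mA := measurable_raised j t.
have mv : measurable_fun setT (v : borel R n -> R) by exact: measurable_pushed.
apply: (@le_trans _ _ (lambda * mass Omega w)%E).
  apply: lee_wpmul2l; first exact: eigenvalue_ge0.
  apply: ge0_le_integral => //.
  - by apply: measurable_funTS; apply/measurable_EFinP; apply: measurable_funX;
      exact: (measurableT_comp _ mv).
  - by apply: measurable_funTS; exact: measurable_norm_exp.
  - by move=> x _; rewrite lee_fin lerXn2r ?nnegrE// !ler0_norm// lerN2 wv.
apply: (le_trans (eigenvalue_mass_le oO kO Omega0 cw w_admissible)).
apply: (le_trans (energy_le_gap Omega0 kO cw oO w_le0 w_out)).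
apply: lee_wpmul2l; first by rewrite lee_fin.
have mg := continuous_gap Omega0 kO (cju (j := j)) ju_out.
have g0 := gap_ge0 Omega0 kO (cju (j := j)) ju_le0 ju_out.
have mgw := continuous_gap Omega0 kO cw w_out.
rewrite -(setIT (raised j K t)) -integral_indic//.
rewrite /gap_integral.
have mI : measurable_fun setT (fun p : borel R n => ((\1_(raised j K t : set (borel R n)) p) : R)%:E).
  by apply/measurable_EFinP; exact: measurable_indic.
rewrite -ge0_integralZl_EFin//; last exact: ltW.
rewrite -ge0_integralD//; last 4 first.
- by move=> p _; rewrite lee_fin.
- by apply/measurable_EFinP; exact: continuous_borel_fun.
- by move=> p _; rewrite -EFinM lee_fin mulr_ge0// ltW.
- exact: measurable_funeM.
apply: ge0_le_integral => //.
- by move=> p _; rewrite lee_fin gap_ge0.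
- by apply/measurable_EFinP; exact: continuous_borel_fun.
- apply: emeasurable_funD; first by apply/measurable_EFinP; exact: continuous_borel_fun.
  exact: measurable_funeM.
move=> p _; rewrite -EFinM -EFinD lee_fin /gap wL addrAC lerD2r indicE.
exact: legendre_pushed_le.
Qed.

End competitor.

(** For j = 0 the bound of [competitor_bound] is finite, while its left-hand
    side is at least lambda |K|. *)
Lemma lebesgue_compact_null : lambda = +oo%E -> lebesgue K = 0%E.
Proof.
move=> loo; apply/eqP; rewrite eq_le lebesgue_ge0 andbT leNgt; apply/negP => Kpos.
have := competitor_bound (lexx 0) (@ltr01 R).
have -> : gap_integral Omega (fun x => 0 * u x) = 0%E.
  rewrite /gap_integral integral0_eq// => p _; congr (_%:E).
  by rewrite /gap (_ : (fun x => 0 * u x) = (fun=> 0)) ?subrr//; apply/funext => x; rewrite mul0r.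
have mK : measurable (K : set (borel R n)).
  by apply: closed_borel; apply: compact_closed => //; exact: norm_hausdorff.
have mO : measurable (Omega : set (borel R n)) by exact: open_borel.
have mv : measurable_fun setT (pushed 0 K 1 : borel R n -> R) by exact: measurable_pushed.
rewrite loo add0e mul1e gt0_mulye; last first.
  apply: (lt_le_trans Kpos); rewrite -[X in (lebesgue X <= _)%E](setIidl KO).
  have <- := @integral_indic _ _ _ leb Omega mO K mK.
  apply: ge0_le_integral => //.
  - by apply/measurable_EFinP; apply: measurable_funTS; exact: measurable_indic.
  - apply: measurable_funTS; apply/measurable_EFinP; apply: measurable_funX.
    exact: (measurableT_comp _ mv).
  move=> x _; rewrite lee_fin indicE /pushed mul0r sub0r mul1r normrN.
  by case: (_ \in _); rewrite /= ?normr1 ?expr1n// exprn_ge0.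
have Af := raised_lty 1 (lexx 0).
by rewrite -(@fineK _ (leb _)) ?ge0_fin_numE ?lebesgue_ge0// -EFinM leNgt ltry.
Qed.

Lemma expr_tangent (a b : R) k : 0 <= a -> 0 <= b ->
  a ^+ k.+1 + k.+1%:R * a ^+ k * b <= (a + b) ^+ k.+1.
Proof.
move=> a0 b0; elim: k => [|k IH]; first by rewrite !expr1 expr0 !mul1r.
rewrite exprS [(a + b) ^+ _]exprS -natr1; have ab : 0 <= a + b by rewrite addr_ge0.
apply: le_trans (ler_wpM2l ab IH).
rewrite exprS; have : 0 <= k.+1%:R * a ^+ k * b * b by rewrite !mulr_ge0// exprn_ge0.
lra.
Qed.

Hypothesis u_energy : energy Omega u = (lambda * mass Omega u)%E.
Hypothesis lambda_fin : lambda \is a fin_num.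

(** The energy of u cancels from both sides of [competitor_bound], and
    what remains is of first order in t by [expr_tangent]. *)
Lemma raised_ge t : 0 < t ->
  (lambda * \int[leb]_(x in K) (`|u x| ^+ n)%:E <= leb (raised 1 K t))%E.
Proof.
move=> t0; have := competitor_bound (@ler01 R) t0.
have -> : (fun x => 1 * u x) = u by apply/funext => x; rewrite mul1r.
have mK : measurable (K : set (borel R n)).
  by apply: closed_borel; apply: compact_closed => //; exact: norm_hausdorff.
have mO : measurable (Omega : set (borel R n)) by exact: open_borel.
have mv : measurable_fun setT (pushed 1 K t : borel R n -> R) by exact: measurable_pushed.
have l0 : (0 <= lambda)%E by exact: eigenvalue_ge0.
have Gle := gap_le_energy Omega0 kO cu oO u_le0 u_out.
rewrite u_energy in Gle.
set I := (\int[leb]_(x in K) _)%E.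
have If : I \is a fin_num.
  rewrite ge0_fin_numE; first exact: (integral_norm_exp_lty kO).
  by apply: integral_ge0 => x _; rewrite lee_fin exprn_ge0.
have mI : (mass Omega u + (n.+1%:R * t)%:E * I <=
    \int[leb]_(x in Omega) (`|pushed 1 K t x| ^+ n.+1)%:E)%E.
  pose P : borel R n -> \bar R := (fun x => (`|u x| ^+ n)%:E) \_ K.
  have P0 x : (0 <= P x)%E by rewrite /P patchE; case: ifP => // _; rewrite lee_fin exprn_ge0.
  have mP : measurable_fun setT P.
    apply/(measurable_restrictT _ mK).
    by apply: measurable_funTS; exact: measurable_norm_exp.
  have nt0 : 0 <= n.+1%:R * t by rewrite mulr_ge0// ltW.
  have -> : I = (\int[leb]_(x in Omega) P x)%E by rewrite /P -integral_mkcondr setIidr.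
  rewrite /mass.
  rewrite -ge0_integralZl_EFin//; last exact: measurable_funTS.
  have mu1 : measurable_fun (Omega : set (borel R n))
    (fun x : borel R n => (`|u x| ^+ n.+1)%:E).
    by apply: measurable_funTS; exact: measurable_norm_exp.
  have mP1 : measurable_fun (Omega : set (borel R n))
    (fun x : borel R n => (n.+1%:R * t)%:E * P x)%E.
    by apply: measurable_funTS; exact: measurable_funeM.
  rewrite -ge0_integralD//; last by move=> x _; rewrite mule_ge0.
  apply: ge0_le_integral => //.
  - by move=> x _; rewrite adde_ge0// mule_ge0.
  - exact: emeasurable_funD.
  - apply: measurable_funTS; apply/measurable_EFinP; apply: measurable_funX.
    exact: (measurableT_comp _ mv).
  move=> x Ox; rewrite /P patchE /pushed mul1r.
  case: ifP => xK; last by rewrite mule0 adde0 mulr0 subr0.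
  rewrite -EFinM -EFinD lee_fin mulr1 ler0_norm// ler0_norm; last by have := u_le0 x; lra.
  rewrite opprB [t - u x]addrC mulrAC; apply: expr_tangent; last exact: ltW.
  by rewrite oppr_ge0.
have mf := mass_fin oO kO cu.
have Gf : gap_integral Omega u \is a fin_num.
  have G0 := gap_integral_ge0 Omega0 kO cu u_le0 u_out.
  rewrite ge0_fin_numE//; apply: (@le_lt_trans _ _ (n.+1%:R%:E * gap_integral Omega u)%E).
    by apply: lee_pemull => //; rewrite lee_fin ler1n.
  by apply: (le_lt_trans Gle); rewrite -(fineK lambda_fin) -(fineK mf) -EFinM ltry.
have Af : leb (raised 1 K t) \is a fin_num by rewrite ge0_fin_numE ?lebesgue_ge0//; exact: raised_lty.
move: mI Gle l0.
rewrite -(fineK lambda_fin) -(fineK Af) -(fineK Gf) -(fineK mf) -(fineK If).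
move=> mI Gle l0 /(le_trans (lee_wpmul2l l0 mI)).
move: l0 Gle; rewrite -!EFinM !lee_fin.
move: (fine _) (fine _) (fine _) (fine _) (fine _) => l m G A I' l0 Gle h.
have n1t : 0 < n.+1%:R * t by rewrite mulr_gt0.
rewrite -(ler_pM2l n1t); lra.
Qed.

(** A slope that is raised for every t > 0 has a maximizer in K, by
    compactness. *)
Lemma monge_ampere_compact_ge :
  (lambda * \int[leb]_(x in K) (`|u x| ^+ n)%:E <= monge_ampere Omega u K)%E.
Proof.
pose A k := raised 1 K k.+1%:R^-1.
have mA k : measurable (A k : set (borel R n)) by exact: measurable_raised.
have mbA : measurable (\bigcap_k (A k : set (borel R n))) by exact: bigcap_measurable.
have A_dec : nonincreasing_seq (A : (set (borel R n))^nat).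
  move=> k l kl; apply/subsetPset; apply: raised_mono.
  by rewrite lef_pV2 ?posrE ?ltr0n// ler_nat.
have cvA : leb (A k) @[k --> \oo] --> leb (\bigcap_k A k).
  apply: (@nonincreasing_cvg_mu _ _ _ leb A) => //.
  exact: raised_lty.
apply: (@le_trans _ _ (leb (\bigcap_k A k))).
  rewrite -(cvg_lim (@ereal_hausdorff R) cvA); apply: lime_ge.
    by apply/cvg_ex; eexists; exact: cvA.
  by near=> k; apply: raised_ge; rewrite invr_gt0 ltr0n.
rewrite /monge_ampere (subdifferential_contact Omega cu) (setIidl KO).
apply: le_lebesgue => p pA.
have [y Ky My] := legendre_max p K0 kK cu.
exists y => //; apply: maximizer_closure => //; first by exact: KS.
move=> z Oz.
have [q q0 Sq] := compact_coord_bounded kO.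
have [M SM] := continuous_lower_bound kO cu.
apply: le_trans (legendre_ub Sq SM p (subset_closure Oz)) _.
apply/ler_addgt0Pr => e e0.
have /= := pA (Num.bound e^-1) I; rewrite /A /raised/=.
have -> : (fun x => 1 * u x) = u by apply/funext => x; rewrite mul1r.
move=> h; apply/ltW; apply: (lt_le_trans h); apply: lerD; first exact: legendre_le.
rewrite -[leRHS]invrK lef_pV2 ?posrE ?ltr0n ?invr_gt0//.
by rewrite (le_trans (ltW (archi_boundP _)))// ?ler_nat// invr_ge0 ltW.
Unshelve. all: by end_near. Qed.

End compact_push.

End variation.

(** * Measures that dominate a density *)

Section dominated_density.
Local Open Scope ereal_scope.
Context d (T : measurableType d) (R : realType).
Variables (m mu : {measure set T -> \bar R}) (D : set T) (rho : T -> R).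
Hypotheses (mD : measurable D) (mrho : measurable_fun setT rho)
  (rho0 : forall x, (0 <= rho x)%R)
  (mu_ge : forall E, measurable E -> E `<=` D ->
    \int[m]_(x in E) (rho x)%:E <= mu E).

Import HBNNSimple.

Let density_indic_le (A : set T) : measurable A ->
  \int[m]_(x in D) (\1_A x * rho x)%:E <= mu (A `&` D).
Proof.
move=> mA; rewrite [leLHS](_ : _ = \int[m]_(x in D `&` A) (rho x)%:E).
  by rewrite setIC; apply: mu_ge; [exact: measurableI|exact: subIsetr].
rewrite integral_mkcondr; apply: eq_integral => x _.
by rewrite patchE indicE; case: ifP => _; rewrite ?mul1r ?mul0r.
Qed.

Let density_nnsfun_le (h : {nnsfun T >-> R}) :
  \int[m]_(x in D) (h x * rho x)%:E <= \int[mu]_(x in D) (h x)%:E.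
Proof.
pose A y := h @^-1` [set y].
have mA y : measurable (A y) by exact: measurable_sfunP.
have mI y : measurable_fun setT (\1_(A y) : T -> R) by exact: measurable_indic.
have hE x : (h x)%:E = \sum_(y \in range h) (y * \1_(A y) x)%:E.
  by rewrite fsumEFin// -fimfunE.
have A0 y x : (0 <= y * \1_(A y) x)%R.
  rewrite indicE; have [/set_mem <-|_] := boolP (x \in A y); last by rewrite mulr0.
  by rewrite mulr1.
have -> : \int[m]_(x in D) (h x * rho x)%:E =
    \sum_(y \in range h) \int[m]_(x in D) (y * \1_(A y) x * rho x)%:E.
  rewrite -ge0_integral_fsum//; last 2 first.
  - move=> y; apply: measurable_funTS; apply/measurable_EFinP.
    by apply: measurable_funM => //; apply: measurable_funM.
  - by move=> y x _; rewrite lee_fin mulr_ge0.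
  apply: eq_integral => x _; rewrite EFinM hE ge0_mule_fsuml; last by move=> y; rewrite lee_fin.
  by apply: eq_fsbigr => y _; rewrite EFinM.
have -> : \int[mu]_(x in D) (h x)%:E =
    \sum_(y \in range h) \int[mu]_(x in D) (y * \1_(A y) x)%:E.
  rewrite -ge0_integral_fsum//; last 2 first.
  - move=> y; apply: measurable_funTS; apply/measurable_EFinP.
    by apply: measurable_funM.
  - by move=> y x _; rewrite lee_fin.
  by apply: eq_integral => x _; rewrite hE.
apply: lee_fsum => // y [x0 _ <-].
have h0 : (0 <= h x0)%R by [].
rewrite (_ : \int[m]_(x in D) _ =
    (h x0)%:E * \int[m]_(x in D) (\1_(A (h x0)) x * rho x)%:E); last first.
  rewrite -ge0_integralZl_EFin//.
  - by apply: eq_integral => x _; rewrite -EFinM mulrA.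
  - by move=> x _; rewrite lee_fin mulr_ge0.
  - by apply: measurable_funTS; apply/measurable_EFinP; apply: measurable_funM.
rewrite (_ : \int[mu]_(x in D) _ =
    (h x0)%:E * \int[mu]_(x in D) (\1_(A (h x0)) x)%:E); last first.
  rewrite -ge0_integralZl_EFin//.
  by apply: measurable_funTS; exact/measurable_EFinP.
by rewrite integral_indic//; apply: lee_wpmul2l => //; exact: density_indic_le.
Qed.

(** The inequality between the two measures passes from sets to integrals of
    nonnegative functions by approximation with simple functions. *)
Lemma density_integral_le (g : T -> R) : measurable_fun setT g ->
    (forall x, (0 <= g x)%R) ->
  \int[m]_(x in D) (g x * rho x)%:E <= \int[mu]_(x in D) (g x)%:E.
Proof.
move=> mg g0.
have mgE : measurable_fun D (EFin \o g) by apply: measurable_funTS; exact/measurable_EFinP.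
pose h := nnsfun_approx mD mgE.
have hg x : D x -> (h k x)%:E @[k --> \oo] --> (g x)%:E.
  by move=> Dx; apply: cvg_nnsfun_approx => // y _; rewrite lee_fin.
have hnd x : D x -> nondecreasing_seq (fun k => h k x).
  by move=> Dx k l kl; exact/lefP/nd_nnsfun_approx.
have hle k x : D x -> (h k x <= g x)%R.
  move=> Dx; rewrite -lee_fin -(cvg_lim (@ereal_hausdorff R) (hg x Dx)).
  apply: lime_ge; first by apply/cvg_ex; eexists; exact: (hg x Dx).
  by near=> l; rewrite lee_fin; apply: hnd => //; near: l; exact: nbhs_infty_ge.
rewrite [leLHS](_ : _ = limn (fun k => \int[m]_(x in D) (h k x * rho x)%:E)).
  apply: lime_le.
    apply: ereal_nondecreasing_is_cvgn => k l kl; apply: ge0_le_integral => //.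
    - by move=> x _; rewrite lee_fin mulr_ge0.
    - by apply: measurable_funTS; apply/measurable_EFinP; apply: measurable_funM.
    - by apply: measurable_funTS; apply/measurable_EFinP; apply: measurable_funM.
    - by move=> x Dx; rewrite lee_fin ler_wpM2r//; exact: hnd.
  near=> k; apply: (le_trans (density_nnsfun_le (h k))).
  apply: ge0_le_integral => //.
  - by move=> x _; rewrite lee_fin.
  - by apply: measurable_funTS; exact/measurable_EFinP.
  - by move=> x Dx; rewrite lee_fin hle.
rewrite -monotone_convergence//.
- apply: eq_integral => x; rewrite inE => Dx; apply/esym/cvg_lim => //.
  rewrite (_ : (fun k => _) = (fun k => (rho x)%:E * (h k x)%:E)); last first.
    by apply/funext => k; rewrite -EFinM mulrC.
  by rewrite mulrC EFinM; apply: cvgeZl => //; exact: hg.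
- by move=> k; apply: measurable_funTS; apply/measurable_EFinP; apply: measurable_funM.
- by move=> k x _; rewrite lee_fin mulr_ge0.
- by move=> x Dx k l kl; rewrite lee_fin ler_wpM2r//; exact: hnd.
Unshelve. all: by end_near. Qed.

Variable g : T -> R.
Hypotheses (mg : measurable_fun setT g) (g0 : forall x, (0 <= g x)%R)
  (g_gt0 : forall x, D x -> (0 < g x)%R)
  (g_eq : \int[mu]_(x in D) (g x)%:E = \int[m]_(x in D) (g x * rho x)%:E)
  (g_fin : \int[mu]_(x in D) (g x)%:E \is a fin_num).

Let superlevel_le (E : set T) (e : R) : measurable E -> E `<=` D -> (0 < e)%R ->
  (forall x, E x -> (e <= g x)%R) -> mu E <= \int[m]_(x in E) (rho x)%:E.
Proof.
move=> mE ED e0 eg.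
pose f x := (g x - e * \1_E x)%R.
have f0 x : (0 <= f x)%R.
  rewrite /f indicE; have [/set_mem/eg|_] := boolP (x \in E).
    by rewrite mulr1 subr_ge0.
  by rewrite mulr0 subr0.
have mI : measurable_fun setT (\1_E : T -> R) by exact: measurable_indic.
have mf : measurable_fun setT f by apply: measurable_funB => //; apply: measurable_funM.
have fle := density_integral_le mf f0.
have gmu : \int[mu]_(x in D) (g x)%:E = \int[mu]_(x in D) (f x)%:E + e%:E * mu E.
  transitivity (\int[mu]_(x in D) ((f x)%:E + e%:E * (\1_E x)%:E)).
    by apply: eq_integral => x _; rewrite -EFinM -EFinD /f subrK.
  rewrite ge0_integralD//; last 4 first.
  - by move=> x _; rewrite lee_fin.
  - by apply: measurable_funTS; exact/measurable_EFinP.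
  - by move=> x _; rewrite -EFinM lee_fin mulr_ge0// ltW.
  - by apply: measurable_funTS; apply: measurable_funeM; exact/measurable_EFinP.
  rewrite ge0_integralZl_EFin ?integral_indic//; last 2 first.
  - by apply: measurable_funTS; exact/measurable_EFinP.
  - exact: ltW.
  by rewrite setIidl.
have gm : \int[m]_(x in D) (g x * rho x)%:E =
    \int[m]_(x in D) (f x * rho x)%:E + e%:E * \int[m]_(x in E) (rho x)%:E.
  rewrite -[X in \int[m]_(x in X) (rho x)%:E](setIidr ED) integral_mkcondr.
  rewrite -ge0_integralZl_EFin//; last 3 first.
  - by move=> x _; rewrite patchE; case: ifP => // _; rewrite lee_fin.
  - apply: measurable_funTS; apply/(measurable_restrictT _ mE).
    by apply: measurable_funTS; exact/measurable_EFinP.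
  - exact: ltW.
  rewrite -ge0_integralD//; last 4 first.
  - by move=> x _; rewrite lee_fin mulr_ge0.
  - by apply: measurable_funTS; apply/measurable_EFinP; apply: measurable_funM.
  - move=> x _; apply: mule_ge0; first by rewrite lee_fin ltW.
    by rewrite patchE; case: ifP => // _; rewrite lee_fin.
  - apply: measurable_funTS; apply: measurable_funeM; apply/(measurable_restrictT _ mE).
    by apply: measurable_funTS; exact/measurable_EFinP.
  apply: eq_integral => x _; rewrite patchE /f indicE; case: ifP => _.
    by rewrite -EFinM -EFinD; congr (_%:E); rewrite mulr1; ring.
  by rewrite mule0 adde0 mulr0 subr0.
have ffin : \int[mu]_(x in D) (f x)%:E \is a fin_num.
  rewrite ge0_fin_numE; last by apply: integral_ge0 => x _; rewrite lee_fin.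
  apply: (@le_lt_trans _ _ (\int[mu]_(x in D) (g x)%:E)); last by rewrite ltey_eq g_fin.
  by rewrite gmu leeDl// mule_ge0// lee_fin ltW.
move: g_eq; rewrite gmu gm => eq.
rewrite -(@lee_pmul2l _ e%:E)//.
rewrite -(@leeD2lE _ _ _ _ ffin) eq.
by rewrite leeD2r.
Qed.

(** Removing e \1_E from g, which leaves it nonnegative where g >= e, and
    comparing the integrals of the rest shows that mu E cannot exceed the
    integral of rho over E.  The sets E /\ {g >= 1/k} exhaust E. *)
Lemma dominated_density_eq (E : set T) : measurable E -> E `<=` D ->
  mu E = \int[m]_(x in E) (rho x)%:E.
Proof.
move=> mE ED; apply/eqP; rewrite eq_le mu_ge// andbT.
pose F k := E `&` [set x | k.+1%:R^-1 <= g x]%R.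
have mF k : measurable (F k).
  rewrite /F; apply: measurableI => //.
  rewrite (_ : [set x | _] = g @^-1` `[(k.+1%:R^-1 : R)%R, +oo[%classic); last first.
    by apply/seteqP; split => x /=; rewrite in_itv/= andbT.
  by rewrite -[X in measurable X]setTI; exact: mg.
have EF : E = \bigcup_k F k.
  apply/seteqP; split => [x Ex|x [k _ []]//].
  have gx := g_gt0 (ED _ Ex).
  exists (Num.bound (g x)^-1) => //; split => //=.
  rewrite -[leRHS]invrK lef_pV2 ?posrE ?ltr0n ?invr_gt0//.
  by rewrite (le_trans (ltW (archi_boundP _)))// ?ler_nat// invr_ge0 ltW.
have Fnd : nondecreasing_seq F.
  move=> k l kl; apply/subsetPset => x [Ex kx]; split => //=; apply: le_trans kx.
  by rewrite lef_pV2 ?posrE ?ltr0n// ler_nat.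
have cv : mu (F k) @[k --> \oo] --> mu E.
  by rewrite EF; apply: (@nondecreasing_cvg_mu _ _ _ mu F) => //; rewrite -EF.
rewrite -(cvg_lim (@ereal_hausdorff R) cv); apply: lime_le.
  by apply/cvg_ex; eexists; exact: cv.
near=> k.
apply: (@le_trans _ _ (\int[m]_(x in F k) (rho x)%:E)).
  apply: (@superlevel_le _ k.+1%:R^-1%R) => //.
  - by move=> x [/ED].
  - by move=> x [].
apply: ge0_subset_integral => //.
- by apply: measurable_funTS; exact/measurable_EFinP.
- by move=> x _; rewrite lee_fin.
- by move=> x [].
Unshelve. all: by end_near. Qed.

End dominated_density.

(** * Minimizers are eigenfunctions *)

Section minimizer.
Context {R : realType} {n : nat}.
Variables (Omega : set 'rV[R]_n) (u : 'rV[R]_n -> R).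
Hypotheses (n0 : (0 < n)%N) (Omega0 : Omega !=set0) (oO : open Omega)
  (kO : compact (closure Omega)) (cvxO : @convex_set R 'rV[R]_n Omega).
Hypotheses (cu : continuous u) (u_cvx : convex_on Omega u)
  (u_out : forall x, ~ Omega x -> u x = 0) (u_neq0 : exists x, u x != 0)
  (u_energy : energy Omega u = (MA_eigenvalue Omega * mass Omega u)%E).
Local Notation leb := (lebesgue : set (borel R n) -> \bar R).
Local Notation lambda := (MA_eigenvalue Omega).
Local Open Scope ereal_scope.

Let u_lt0 x : Omega x -> (u x < 0)%R.
Proof. exact: convex_lt0. Qed.

Let mO : measurable (Omega : set (borel R n)).
Proof. exact: open_borel. Qed.

Let compact_borel (K : set 'rV[R]_n) : compact K -> measurable (K : set (borel R n)).
Proof.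
by move=> kK; apply: closed_borel; apply: compact_closed => //; exact: norm_hausdorff.
Qed.

Let inner (E : set (borel R n)) (e : R) : measurable E -> E `<=` Omega -> (0 < e)%R ->
  exists K : set 'rV[R]_n, [/\ compact K, K `<=` E & lebesgue (E `\` K) <= e%:E].
Proof.
move=> mE EO; have [r r0 Sr] := compact_coord_bounded kO.
by apply: (@lebesgue_inner_regular _ _ _ r) => // x /EO Ox; apply/Sr/subset_closure.
Qed.

Lemma domain_null : lambda = +oo -> lebesgue Omega = 0.
Proof.
move=> loo; apply/eqP; rewrite eq_le lebesgue_ge0 andbT.
apply/lee_addgt0Pr => e e0; rewrite add0e.
have [K [kK KO Ke]] := inner mO (fun x Ox => Ox) e0.
apply: le_trans Ke; rewrite [leLHS](_ : _ = lebesgue ((Omega `\` K) `|` K)).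
  have [K0|/nonemptyPn ->] := pselect (K !=set0); last by rewrite setU0.
  rewrite lebesgue_setU_null//.
  exact: (lebesgue_compact_null Omega0 oO kO cvxO cu u_cvx u_out u_lt0 kK K0 KO).
by rewrite setDKU.
Qed.

Lemma mass_le_monge_ampere (E : set (borel R n)) : lambda \is a fin_num ->
    measurable E -> E `<=` Omega ->
  \int[leb]_(x in E) (fine lambda * `|u x| ^+ n)%:E <= monge_ampere Omega u E.
Proof.
move=> lfin mE EO.
have [M uM] := continuous_lower_bound kO cu.
have l0 : 0 <= lambda by exact: eigenvalue_ge0.
have fl0 : (0 <= fine lambda)%R by rewrite fine_ge0.
have u_le_M x : Omega x -> (`|u x| <= `|M|)%R.
  move=> Ox; rewrite ltr0_norm ?u_lt0// lerNl (le_trans _ (uM x (subset_closure Ox)))//.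
  by rewrite lerN2 ler_norm.
pose rho x := (fine lambda * `|u x| ^+ n)%R.
have rho0 x : (0 <= rho x)%R by rewrite mulr_ge0// exprn_ge0.
have mrho : measurable_fun setT (fun x : borel R n => (rho x)%:E).
  by under eq_fun do rewrite EFinM; apply: measurable_funeM; exact: measurable_norm_exp.
pose C := (fine lambda * `|M| ^+ n)%R.
have C0 : (0 <= C)%R by rewrite mulr_ge0// exprn_ge0.
apply/lee_addgt0Pr => e e0.
have e1 : (0 < e / (C + 1))%R by rewrite divr_gt0// ltr_wpDl.
have [K [kK KE Ke]] := inner mE EO e1.
have mK := compact_borel kK.
rewrite -{1}(setDUK KE) ge0_integral_setU//; last 4 first.
- exact: measurableD.
- exact: measurable_funTS.
- by move=> x _; rewrite lee_fin rho0.
- by apply/disj_setPS => x [Kx []].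
apply: leeD.
  apply: (@le_trans _ _ (monge_ampere Omega u K)); last first.
    apply: le_lebesgue => p [x [Kx Ox] px].
    by exists x => //; split => //; exact: KE.
  have [K0|/nonemptyPn ->] := pselect (K !=set0); last first.
    by rewrite integral_set0 lebesgue_ge0.
  have KO : K `<=` Omega by move=> x /KE /EO.
  apply: le_trans (monge_ampere_compact_ge Omega0 oO kO cvxO cu u_cvx u_out
    u_lt0 kK K0 KO u_energy lfin).
  rewrite -[X in _ <= X * _](fineK lfin) -ge0_integralZl_EFin//.
  by apply: measurable_funTS; exact: measurable_norm_exp.
apply: (@le_trans _ _ (\int[leb]_(x in E `\` K) C%:E)).
  apply: ge0_le_integral => //.
  - exact: measurableD.
  - by move=> x _; rewrite lee_fin rho0.
  - exact: measurable_funTS.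
  - move=> x [/EO Ox _]; rewrite lee_fin ler_wpM2l// lerXn2r ?nnegrE//.
    exact: u_le_M.
rewrite integral_cst//; last exact: measurableD.
apply: (@le_trans _ _ (C%:E * (e / (C + 1))%:E)).
  by apply: lee_wpmul2l => //; rewrite lee_fin.
rewrite -EFinM lee_fin mulrA ler_pdivrMr ?ltr_wpDl// mulrC ler_wpM2l ?ltW//; lra.
Qed.

Lemma minimizer_solution (E : set (borel R n)) : measurable E -> E `<=` Omega ->
  monge_ampere Omega u E = \int[leb]_(x in E) (lambda * (`|u x| ^+ n)%:E).
Proof.
move=> mE EO.
have u_le0 x : (u x <= 0)%R by have [/u_lt0/ltW|/u_out ->] := pselect (Omega x).
have mT := measurable_contact_point Omega0 kO cu.
pose mu := mrestr (pushforward leb (contact_point Omega u)) mO.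
have muE A : monge_ampere Omega u A = mu A.
  by rewrite (monge_ampere_pushforward Omega0 kO cu).
have mu_int : \int[mu]_(x in (Omega : set (borel R n))) `|u x|%:E = energy Omega u.
  by rewrite /energy (_ : monge_ampere Omega u = mu)//; apply/funext.
have mau : measurable_fun setT (fun x : borel R n => `|u x|%R).
  by apply: measurableT_comp => //; exact: continuous_borel_fun.
have u_gt0 x : Omega x -> (0 < `|u x|)%R by move=> /u_lt0 ux; rewrite normr_gt0 lt_eqF.
have l0 : 0 <= lambda by exact: eigenvalue_ge0.
have mrho : measurable_fun setT (fun x : borel R n => fine lambda * `|u x| ^+ n)%R.
  by apply: measurable_funM => //; apply: measurable_funX.
have rho0 x : (0 <= fine lambda * `|u x| ^+ n)%R by rewrite mulr_ge0 ?fine_ge0// exprn_ge0.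
have mass_f := mass_fin oO kO cu.
(* fine sends +oo to 0, so that fine lambda |u|^n is the right density even if
   lambda is infinite, in which case Omega is a null set *)
have [rho_ge rho_mass rho_lambda] : [/\
    forall A : set (borel R n), measurable A -> A `<=` Omega ->
      \int[leb]_(x in A) (fine lambda * `|u x| ^+ n)%:E <= mu A,
    (fine lambda)%:E * mass Omega u = lambda * mass Omega u &
    forall A : set (borel R n), measurable A -> A `<=` Omega ->
      \int[leb]_(x in A) (fine lambda * `|u x| ^+ n)%:E =
      \int[leb]_(x in A) (lambda * (`|u x| ^+ n)%:E)].
  have [lfin|loo] := boolP (lambda \is a fin_num).
    split => [A mA AO||A mA AO]; first by rewrite -muE; exact: mass_le_monge_ampere.
    - by rewrite fineK.
    - by apply: eq_integral => x _; rewrite EFinM fineK.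
  have {}loo : lambda = +oo by apply/eqP; move: loo; rewrite ge0_fin_numE// -leNgt leye_eq.
  have null (A : set (borel R n)) (f : borel R n -> \bar R) : measurable A -> A `<=` Omega ->
      measurable_fun setT f -> (forall x, 0 <= f x) -> \int[leb]_(x in A) f x = 0.
    move=> mA AO mf f0; rewrite (@ge0_negligible_integral _ _ _ leb A A)//.
    - by rewrite setDv integral_set0.
    - exact: measurable_funTS.
    - apply/eqP; rewrite eq_le lebesgue_ge0 andbT -(domain_null loo).
      exact: le_lebesgue.
  rewrite loo /= /mass; split => [A mA AO||A mA AO].
  - by rewrite integral0_eq => [|x _]; [exact: lebesgue_ge0|rewrite mul0r].
  - by rewrite null ?mule0//; exact: measurable_norm_exp.
  - have -> : \int[leb]_(x in A) (+oo * (`|u x| ^+ n)%:E) = 0.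
      by apply: null => //; apply: measurable_funeM; exact: measurable_norm_exp.
    by apply: integral0_eq => x _; rewrite mul0r.
rewrite -rho_lambda// muE.
have energyE : \int[leb]_(x in Omega) (`|u x| * (fine lambda * `|u x| ^+ n))%:E = energy Omega u.
  rewrite u_energy -rho_mass /mass -ge0_integralZl_EFin//; last 2 first.
  - by apply: measurable_funTS; exact: measurable_norm_exp.
  - exact: fine_ge0.
  by apply: eq_integral => x _; rewrite -EFinM; congr (_%:E); rewrite exprS mulrCA.
apply: (@dominated_density_eq _ _ _ leb mu Omega _ mO mrho rho0 rho_ge (fun x => `|u x|%R)) => //.
  by rewrite mu_int energyE.
by rewrite mu_int u_energy -rho_mass fin_numM.
Qed.

End minimizer.

Theorem theorem1p8 (R : realType) (n : nat) (n_ge2 : (2 <= n)%N)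
    (Omega : set 'rV[R]_n) (dom_Omega : domain Omega) (bnd_Omega : bounded_set Omega)
    (cvx_Omega : @convex_set R 'rV[R]_n Omega)
    (u : 'rV[R]_n -> R)
    (u_cont : {within closure Omega, continuous u})
    (u_convex : convex_on Omega u)
    (u_neq0 : exists2 x, Omega x & u x != 0)
    (u_frontier : forall x, frontier Omega x -> u x = 0)
    (u_energy : (energy Omega u = MA_eigenvalue Omega * mass Omega u)%E) :
  MA_eigenfunction Omega u.
Proof.
split => //; split => // E mE EO.
have [neO oO _] := dom_Omega.
have kO : compact (closure Omega).
  have [M [_ OM]] := bnd_Omega.
  have OQ y : Omega y -> forall i, `|y ord0 i| <= `|M| + 1.
    move=> Oy i; apply: (le_trans (coord_le_norm y i)); apply: OM => //.
    by rewrite (le_lt_trans (ler_norm _))// ltrDl.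
  have kQ := @compact_coord_cube R n (`|M| + 1).
  apply: (subclosed_compact _ kQ); first exact: closed_closure.
  rewrite [X in _ `<=` X](iffLR (closure_id _)); first exact: closureS.
  by apply: compact_closed => //; exact: norm_hausdorff.
have eqw x : Omega x -> u x = (u \_ Omega) x by move=> Ox; rewrite patchE mem_set.
have w_out x : ~ Omega x -> (u \_ Omega) x = 0%R.
  by move=> nOx; rewrite patchE memNset.
rewrite (eq_monge_ampere eqw) (@minimizer_solution R n Omega (u \_ Omega))//.
- apply: eq_integral => x; rewrite inE => /EO/eqw ->//.
- by apply: leq_trans n_ge2.
- exact: continuous_extension.
- exact: eq_convex_on u_convex.
- by have [x Ox ux] := u_neq0; exists x; rewrite -eqw.
- by rewrite -(eq_energy eqw) -(eq_mass eqw).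
Qed.
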